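(* Let $G$ be an arbitrary finite group and $k$ an arbitrary field. Then there is a polynomial ring $S=k[t_1,\dots,t_n]$ over $k$ (for some $n\ge 0$) and a faithful action of $G$ on $S$ by $k$-algebra automorphisms (not necessarily linear, i.e. not necessarily preserving the grading of $S$) such that the ring of invariants $S^G$ is a Cohen-Macaulay ring.
   Context: For a commutative $k$-algebra $S$ on which $G$ acts by $k$-algebra automorphisms, $S^G=\{s\in S : sg=s \ \forall g\in G\}$ is the ring of invariants. *)

(* Defs.v *)
From HB Require Import structures.
From mathcomp Require Import all_boot all_fingroup all_algebra.
From mathcomp Require Import generic_quotient ring_quotient ring boolp.

Set Implicit Arguments.
Unset Strict Implicit.
Unset Printing Implicit Defensive.

Import GRing.Theory.
Local Open Scope ring_scope.
Local Open Scope quotient_scope.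

(* As in ring_quotient, ideals are boolean predicates. Every proposition is
   decidable by boolp, so [idealr R] is the type of all proper ideals of R, and
   [prime_idealr R] the type of all its prime ideals. *)

Module Localization.
Section Localization.
Variables (R : comNzRingType) (P : prime_idealr R).

Lemma notin_prime1 : 1 \notin P.
Proof. by rewrite idealr1. Qed.

Lemma notin_primeM (s t : {s : R | s \notin P}) : sval s * sval t \notin P.
Proof. by rewrite prime_idealrM negb_or (svalP s) (svalP t). Qed.

Definition den1 : {s : R | s \notin P} := exist _ 1 notin_prime1.
Definition denM (s t : {s : R | s \notin P}) : {s : R | s \notin P} :=
  exist _ (sval s * sval t) (notin_primeM s t).

Definition frac := (R * {s : R | s \notin P})%type.
Implicit Types x y z : frac.

(* The factor u is needed because R may have zero divisors. *)
Definition equivl x y : bool :=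
  `[< exists2 u : R, u \notin P & u * (x.1 * sval y.2 - y.1 * sval x.2) = 0 >].

Lemma equivl_refl : ssrbool.reflexive equivl.
Proof.
by move=> x; apply/asboolP; exists 1; rewrite ?notin_prime1 // subrr mulr0.
Qed.

Lemma equivl_sym : ssrbool.symmetric equivl.
Proof.
suff H x y : equivl x y -> equivl y x by move=> x y; apply/idP/idP; exact: H.
move=> /asboolP[u uP e]; apply/asboolP; exists u => //.
by rewrite -opprB mulrN e oppr0.
Qed.

Lemma equivl_trans : ssrbool.transitive equivl.
Proof.
move=> [b t] [a s] [c r] /asboolP[u uP /= e1] /asboolP[v vP /= e2].
apply/asboolP; exists (u * v * sval t) => /=.
  by rewrite !prime_idealrM !negb_or uP vP (svalP t).
have -> : u * v * sval t * (a * sval r - c * sval s) =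
  v * sval r * (u * (a * sval t - b * sval s)) +
  u * sval s * (v * (b * sval r - c * sval t)) by ring.
by rewrite e1 e2 !mulr0 addr0.
Qed.

Canonical equivl_equiv := EquivRel equivl equivl_refl equivl_sym equivl_trans.

Definition type := {eq_quot equivl}.
HB.instance Definition _ : EqQuotient _ equivl type := EqQuotient.on type.
HB.instance Definition _ := Choice.on type.

Lemma eqlP x y :
  reflect (exists2 u : R, u \notin P & u * (x.1 * sval y.2 - y.1 * sval x.2) = 0)
          (x == y %[mod type]).
Proof. by rewrite eqmodE; apply: asboolP. Qed.

Lemma eq_pi x y : x.1 * sval y.2 = y.1 * sval x.2 -> \pi_type x = \pi_type y.
Proof.
move=> e; apply/eqP/eqlP; exists 1; first exact: notin_prime1.
by rewrite e subrr mulr0.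
Qed.

Lemma repr_pi x : exists2 u : R, u \notin P &
  u * (x.1 * sval (repr (\pi_type x)).2 - (repr (\pi_type x)).1 * sval x.2) = 0.
Proof. by apply/eqlP; rewrite reprK. Qed.

Definition addl x y : frac := (x.1 * sval y.2 + y.1 * sval x.2, denM x.2 y.2).
Definition oppl x : frac := (- x.1, x.2).
Definition mull x y : frac := (x.1 * y.1, denM x.2 y.2).

Definition add := lift_op2 type addl.
Definition opp := lift_op1 type oppl.
Definition mul := lift_op2 type mull.
Definition toloc := lift_embed type (fun a : R => (a, den1) : frac).
Canonical toloc_pi_morph := PiEmbed toloc.

Lemma pi_add : {morph \pi : x y / addl x y >-> add x y}.
Proof.
move=> x y; unlock add; apply/eqP/eqlP.
have [u uP eu] := repr_pi x; have [v vP ev] := repr_pi y.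
exists (u * v); first by rewrite prime_idealrM negb_or uP vP.
move: eu ev; set x' := repr _; set y' := repr _ => eu ev /=.
transitivity
  (v * sval y.2 * sval y'.2 * (u * (x.1 * sval x'.2 - x'.1 * sval x.2)) +
   u * sval x.2 * sval x'.2 * (v * (y.1 * sval y'.2 - y'.1 * sval y.2))).
  by ring.
by rewrite eu ev !mulr0 addr0.
Qed.
Canonical pi_add_morph := PiMorph2 pi_add.

Lemma pi_opp : {morph \pi : x / oppl x >-> opp x}.
Proof.
move=> x; unlock opp; apply/eqP/eqlP.
have [u uP eu] := repr_pi x; exists u => //=.
by rewrite !mulNr -opprD mulrN eu oppr0.
Qed.
Canonical pi_opp_morph := PiMorph1 pi_opp.

Lemma pi_mul : {morph \pi : x y / mull x y >-> mul x y}.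
Proof.
move=> x y; unlock mul; apply/eqP/eqlP.
have [u uP eu] := repr_pi x; have [v vP ev] := repr_pi y.
exists (u * v); first by rewrite prime_idealrM negb_or uP vP.
move: eu ev; set x' := repr _; set y' := repr _ => eu ev /=.
transitivity
  (v * y.1 * sval y'.2 * (u * (x.1 * sval x'.2 - x'.1 * sval x.2)) +
   u * x'.1 * sval x.2 * (v * (y.1 * sval y'.2 - y'.1 * sval y.2))).
  by ring.
by rewrite eu ev !mulr0 addr0.
Qed.
Canonical pi_mul_morph := PiMorph2 pi_mul.

Lemma addA : associative add.
Proof.
elim/quotW=> x; elim/quotW=> y; elim/quotW=> z; rewrite !piE.
by apply: eq_pi => /=; ring.
Qed.

Lemma addC : commutative add.
Proof.
elim/quotW=> x; elim/quotW=> y; rewrite !piE.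
by apply: eq_pi => /=; ring.
Qed.

Lemma add0 : left_id (toloc 0) add.
Proof. by elim/quotW=> x; rewrite !piE; apply: eq_pi => /=; ring. Qed.

Lemma addN : left_inverse (toloc 0) opp add.
Proof. by elim/quotW=> x; rewrite !piE; apply: eq_pi => /=; ring. Qed.

HB.instance Definition _ := GRing.isZmodule.Build type addA addC add0 addN.

Lemma mulA : associative mul.
Proof.
elim/quotW=> x; elim/quotW=> y; elim/quotW=> z; rewrite !piE.
by apply: eq_pi => /=; ring.
Qed.

Lemma mulC : commutative mul.
Proof.
elim/quotW=> x; elim/quotW=> y; rewrite !piE.
by apply: eq_pi => /=; ring.
Qed.

Lemma mul1 : left_id (toloc 1) mul.
Proof. by elim/quotW=> x; rewrite !piE; apply: eq_pi => /=; ring. Qed.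

Lemma mul_addl : left_distributive mul add.
Proof.
elim/quotW=> x; elim/quotW=> y; elim/quotW=> z; rewrite !piE.
by apply: eq_pi => /=; ring.
Qed.

Lemma nonzero1 : toloc 1 != toloc 0.
Proof.
rewrite !piE; apply/negP => /asboolP[u uP] /=.
by rewrite mulr1 mul0r subr0 mulr1 => u0; rewrite u0 idealr0 in uP.
Qed.

HB.instance Definition _ :=
  GRing.Zmodule_isComNzRing.Build type mulA mulC mul1 mul_addl nonzero1.

End Localization.
End Localization.
HB.export Localization.

Notation localization := Localization.type.

Section CohenMacaulay.
Variable R : comNzRingType.

Definition ideal_gen (s : seq R) (x : R) : Prop :=
  exists c : 'I_(size s) -> R, x = \sum_(i < size s) c i * s`_i.

(* The improper ideal, which [idealr R] omits, is generated by 1. *)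
Definition noetherian : Prop :=
  forall I : idealr R, exists s, forall x, x \in I <-> ideal_gen s x.

Definition maximal_ideal (m : {pred R}) : Prop :=
  forall J : idealr R, {subset m <= J} -> {subset J <= m}.

Definition prime_chain (d : nat) (P : nat -> prime_idealr R) : Prop :=
  forall i, (i < d)%N ->
    {subset P i <= P i.+1} /\ ~ {subset P i.+1 <= P i}.

Definition krull_dim (d : nat) : Prop :=
  (exists P, prime_chain d P) /\ (forall e P, prime_chain e P -> (e <= d)%N).

Definition regular_sequence (s : seq R) : Prop :=
  (forall i, (i < size s)%N -> forall x,
    ideal_gen (take i s) (s`_i * x) -> ideal_gen (take i s) x) /\
  ~ ideal_gen s 1.

Definition depth (m : {pred R}) (d : nat) : Prop :=
  (exists s, [/\ size s = d, {subset s <= m} & regular_sequence s]) /\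
  (forall s, {subset s <= m} -> regular_sequence s -> (size s <= d)%N).

Definition cohen_macaulay_local : Prop :=
  noetherian /\
  exists m : idealr R,
    [/\ maximal_ideal m,
        forall m' : idealr R, maximal_ideal m' -> m' =i m
      & exists d, krull_dim d /\ depth m d].

End CohenMacaulay.

(* Quantifying over [prime_idealr] loses nothing: maximal ideals are prime. *)
Definition cohen_macaulay (R : comNzRingType) : Prop :=
  noetherian R /\
  forall m : prime_idealr R, maximal_ideal m ->
    cohen_macaulay_local (localization m).

Section AlgebraAction.
Variables (G : finGroupType) (k : fieldType) (S : comAlgType k).

(* [action] is a right action; bijectivity of each map follows from it. *)
Record alg_action := AlgAction {
  aact :> {action G &-> S};
  aact_linear : forall g : G, linear (fun s => aact s g);
  aact_monoid_morphism : forall g : G, monoid_morphism (fun s => aact s g) }.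

Definition faithful_action (a : alg_action) : Prop :=
  forall g : G, (forall s, a s g = s) -> g = 1%g.

Definition invariants (a : alg_action) : {pred S} :=
  [pred s | [forall g : G, a s g == s]].

Variable a : alg_action.

Lemma invariantsP (s : S) :
  reflect (forall g : G, a s g = s) (s \in invariants a).
Proof. by apply: (iffP forallP) => h g; apply/eqP; exact: h. Qed.

Lemma invariants_subalg : subalg_closed (invariants a).
Proof.
split.
- by apply/invariantsP => g; case: (aact_monoid_morphism a g).
- move=> c u v /invariantsP hu /invariantsP hv; apply/invariantsP => g.
  by have := aact_linear a g c u v; rewrite /= hu hv.
- move=> u v /invariantsP hu /invariantsP hv; apply/invariantsP => g.
  by case: (aact_monoid_morphism a g) => _ /(_ u v) /=; rewrite hu hv.
Qed.

HB.instance Definition _ :=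
  GRing.isSubalgClosed.Build k S (invariants a) invariants_subalg.

Record invariant_ring : predArgType :=
  InvariantRing { invring_val : S; _ : invring_val \in invariants a }.

HB.instance Definition _ := [isSub for invring_val].
HB.instance Definition _ := [Choice of invariant_ring by <:].
HB.instance Definition _ :=
  [SubChoice_isSubAlgebra of invariant_ring by <:].
HB.instance Definition _ :=
  [SubNzRing_isSubComNzRing of invariant_ring by <:].

End AlgebraAction.

(* Main.v *)
(* Let G permute N = n + 1 = #|G| elements x_0, ..., x_n by translation. Taking
   x_n = 1 - x_0 - ... - x_(n-1) makes this a faithful affine action on
   S = k[x_0, ..., x_(n-1)], and the trace of x_0 over G is 1. Hence
   s |-> trace (x_0 * s) is an A-linear retraction of S onto A = S^G, so A
   inherits from S the noetherian property and the regularity of sequences of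
   elements of A, and every maximal ideal m of A lies under a maximal ideal of S.

   A chain of e + 1 primes of A gives e algebraically independent elements of S,
   so dim A <= n. By the Nullstellensatz, m contains p_a(c_a) for monic
   nonconstant p_a, where -c_a, for a < n, is the coefficient of T^a in the
   invariant polynomial F = prod_i (T - x_i). The n elements p_a(c_a) form a
   regular sequence of S: starting from the variables, exchange x_a for c_a, for
   a decreasing; F(x_a) = 0 makes c_a monic in x_a over the algebra of the other
   entries, so the substitution exhibits a polynomial ring as a free module over
   itself. Finally a regular sequence of length n in A_m yields a chain of n + 1
   primes, so n = dim A_m = depth A_m. *)

From HB Require Import structures.
Require Import Defs.
From mathcomp Require Import all_boot all_fingroup all_algebra.
From mathcomp Require Import mpoly generic_quotient ring_quotient ring boolp zify.
From mathcomp Require classical_sets.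

Set Implicit Arguments.
Unset Strict Implicit.
Unset Printing Implicit Defensive.

Import GRing.Theory.
Local Open Scope ring_scope.

(** * Ideals, primes and regular sequences *)

Section Ideals.
Variable R : comNzRingType.
Implicit Types (I J T : R -> Prop) (s : seq R).

(** Unlike [idealr], this covers the unit ideal and applies to bare predicates. *)
Definition is_ideal I : Prop :=
  [/\ I 0, forall x y, I x -> I y -> I (x + y) & forall a x, I x -> I (a * x)].

Lemma idealN I x : is_ideal I -> I x -> I (- x).
Proof. by case=> _ _ IM Ix; rewrite -mulN1r; apply: IM. Qed.

Lemma idealB I x y : is_ideal I -> I x -> I y -> I (x - y).
Proof. by move=> idI Ix /(idealN idI); case: idI => _ ID _; apply: ID. Qed.

Lemma ideal_sum I (K : Type) (r : seq K) (P : pred K) (F : K -> R) :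
  is_ideal I -> (forall i, P i -> I (F i)) -> I (\sum_(i <- r | P i) F i).
Proof. by case=> I0 ID _ IF; elim/big_ind: _. Qed.

Lemma ideal_gen_ideal s : is_ideal (ideal_gen s).
Proof.
split.
- by exists (fun=> 0); rewrite big1 // => i _; rewrite mul0r.
- move=> x y [c ->] [d ->]; exists (fun i => c i + d i).
  by rewrite -big_split; apply: eq_bigr => i _; rewrite mulrDl.
- move=> a x [c ->]; exists (fun i => a * c i).
  by rewrite mulr_sumr; apply: eq_bigr => i _; rewrite mulrA.
Qed.

Lemma ideal_gen_mem s x : x \in s -> ideal_gen s x.
Proof.
move=> /(nthP 0)[i lt_is <-]; exists (fun j => (j == Ordinal lt_is)%:R).
rewrite (bigD1 (Ordinal lt_is)) //= eqxx mul1r big1 ?addr0 // => j /negPf ->.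
by rewrite mul0r.
Qed.

Lemma ideal_gen_min s I : is_ideal I -> (forall x, x \in s -> I x) ->
  forall x, ideal_gen s x -> I x.
Proof.
move=> idI sI _ [c ->]; apply: ideal_sum => // i _.
by case: idI => _ _ IM; apply/IM/sI/mem_nth.
Qed.

Lemma ideal_gen_sub s t x : {subset s <= t} -> ideal_gen s x -> ideal_gen t x.
Proof.
move=> st; apply: ideal_gen_min => [|y /st]; first exact: ideal_gen_ideal.
exact: ideal_gen_mem.
Qed.

Lemma is_ideal_idealr (J : idealr R) : is_ideal (fun x => x \in J).
Proof.
by split=> [|x y|a x]; [apply: rpred0 | apply: rpredD | apply: idealMr].
Qed.

Lemma idealr_of I : is_ideal I -> ~ I 1 ->
  {J : idealr R | forall x, x \in J <-> I x}.
Proof.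
case=> I0 ID IM I1; pose S : {pred R} := fun x => `[< I x >].
have clS : idealr_closed S.
  split=> [||a u v /asboolP Iu /asboolP Iv]; apply/asboolP => //.
  by apply: ID => //; apply: IM.
pose J : idealr R := HB.pack (S : R -> bool) (isIdealr.Build R S clS).
by exists J => x; split=> [/asboolP|Ix] //; apply/asboolP.
Qed.

Lemma prime_idealr_of I : is_ideal I -> ~ I 1 ->
    (forall x y, I (x * y) -> I x \/ I y) ->
  {J : prime_idealr R | forall x, x \in J <-> I x}.
Proof.
case=> I0 ID IM I1 IP; pose S : {pred R} := fun x => `[< I x >].
have clS : idealr_closed S.
  split=> [||a u v /asboolP Iu /asboolP Iv]; apply/asboolP => //.
  by apply: ID => //; apply: IM.
have prS : prime_idealr_closed S.
  move=> u v /asboolP/IP[] h; apply/orP; [left|right]; exact/asboolP.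
pose J : prime_idealr R := HB.pack (S : R -> bool) (isIdealr.Build R S clS)
  (isPrimeIdealrClosed.Build R S prS).
by exists J => x; split=> [/asboolP|Ix] //; apply/asboolP.
Qed.

Lemma noetherianP : noetherian R <->
  forall I, is_ideal I -> exists s, forall x, I x <-> ideal_gen s x.
Proof.
split=> [noR I idI | noR I]; last first.
  by have [s sI] := noR _ (is_ideal_idealr I); exists s.
case: (pselect (I 1)) => [I1|nI1].
  exists [:: 1] => x; case: idI (ideal_gen_ideal [:: 1]) => _ _ IM [_ _ GM].
  split=> _; rewrite -[x]mulr1; first by apply/GM/ideal_gen_mem/mem_head.
  exact: IM.
have [J JI] := idealr_of idI nI1; have [s sJ] := noR J.
by exists s => x; rewrite -JI.
Qed.

(** Meant for coefficient maps [f]: the finitely many generators of the ideal of values are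
    remembered together with polynomials that realise them. *)
Lemma noetherian_lift (V : eqType) (I : V -> Prop) (f : V -> R) :
    noetherian R -> is_ideal (fun x => exists2 v, I v & f v = x) ->
  exists t : seq V, (forall v, v \in t -> I v) /\
    forall v, I v -> ideal_gen [seq f w | w <- t] (f v).
Proof.
move=> /noetherianP noR /noR[s sP].
have [t [It ft]] : exists t : seq V,
    (forall v, v \in t -> I v) /\ [seq f w | w <- t] = s.
  have : forall x, x \in s -> exists2 v, I v & f v = x.
    by move=> x /ideal_gen_mem/sP.
  elim: {sP} s => [|x s IHs] sI; first by exists [::].
  have [v Iv fv] := sI x (mem_head _ _).
  case: IHs => [y ys|t [It ft]]; first by apply: sI; rewrite in_cons ys orbT.
  exists (v :: t); split=> [w|/=]; last by rewrite fv ft.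
  by rewrite in_cons => /orP[/eqP->|/It].
by exists t; split=> // v Iv; rewrite ft -sP; exists v.
Qed.

(** By Zorn's lemma some ideal is maximal among those containing [I] and missing the multiplicative
    set [T], and such an ideal is prime. Its maximality is kept in the conclusion, for the
    construction of maximal ideals. *)
Lemma krull_prime I T : is_ideal I -> T 1 ->
    (forall x y, T x -> T y -> T (x * y)) -> (forall x, I x -> ~ T x) ->
  exists Q : prime_idealr R,
    [/\ forall x, I x -> x \in Q, forall x, x \in Q -> ~ T x
      & forall J, is_ideal J -> (forall x, x \in Q -> J x) ->
          (forall x, J x -> ~ T x) -> forall x, J x -> x \in Q].
Proof.
move=> idI T1 TM IT.
pose good (J : R -> Prop) := [/\ is_ideal J, forall x, I x -> J x
  & forall x, J x -> ~ T x].
pose le (J K : {X | good X}) := `[< forall x, sval J x -> sval K x >].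
have [|J K L /asboolP JK /asboolP KL|[J gJ] [K gK] /asboolP JK /asboolP KJ
     |F totF|[Q [idQ IQ QT]] maxQ] := @classical_sets.Zorn {X | good X} le.
- by move=> J; apply/asboolP.
- by apply/asboolP => x /JK/KL.
- have e : J = K by apply/funext => x; apply/propext; split=> [/JK|/KJ].
  by case: _ / e gK {JK KJ} => gK; congr exist; apply: Prop_irrelevance.
(* A nonempty chain is bounded by its union, the empty one by [I] itself. *)
- case: (pselect (exists X, F X)) => [[J0 FJ0]|noF]; last first.
    by exists (exist _ I (And3 idI (fun x => id) IT)) => J FJ; case: noF; exists J.
  pose U x := exists2 X, F X & sval X x.
  have gU : good U.
    split=> [|x Ix|x [J _ Jx]]; last by case: (svalP J) => _ _; apply.
    - split=> [|x y [J FJ Jx] [K FK Ky]|a x [J FJ Jx]].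
      + by exists J0 => //; case: (svalP J0) => -[].
      + have [/asboolP JK|/asboolP KJ] := totF _ _ FJ FK.
          exists K => //; case: (svalP K) => -[_ KD _] _ _.
          by apply: KD => //; apply: JK.
        exists J => //; case: (svalP J) => -[_ JD _] _ _.
        by apply: JD => //; apply: KJ.
      + by exists J => //; case: (svalP J) => -[_ _ JM] _ _; apply: JM.
    - by exists J0 => //; case: (svalP J0) => _ + _; apply.
  by exists (exist _ U gU) => J FJ; apply/asboolP => x Jx; exists J.
have maxQ' J : is_ideal J -> (forall x, Q x -> J x) ->
    (forall x, J x -> ~ T x) -> forall x, J x -> Q x.
  move=> idJ QJ JT x Jx.
  have gJ : good J by split=> // y /IQ/QJ.
  have /maxQ/(congr1 sval)/= <- // : le (exist _ Q (And3 idQ IQ QT)) (exist _ J gJ).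
  exact/asboolP.
have {maxQ} Q1 : ~ Q 1 by move/QT.
(* The ideal Q + (a). If a is not in Q, it meets [T] by maximality. For a = x and a = y this gives
   two elements of [T] whose product would lie in Q as soon as x y does. *)
pose adj a y := exists q r, Q q /\ y = q + r * a.
have id_adj a : is_ideal (adj a).
  case: idQ => Q0 QD QM; split=> [|y z [q [r [Qq ->]]] [q' [r' [Qq' ->]]]|b y [q [r [Qq ->]]]].
  - by exists 0, 0; rewrite mul0r addr0.
  - by exists (q + q'), (r + r'); split; [apply: QD | ring].
  - by exists (b * q), (b * r); split; [apply: QM | ring].
have hit a : ~ Q a -> exists q r, Q q /\ T (q + r * a).
  move=> nQa; apply: contrapT => noT; apply: nQa.
  apply: (maxQ' _ (id_adj a)).
  - by move=> y Qy; exists y, 0; rewrite mul0r addr0.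
  - by move=> _ [q [r [Qq ->]]] Ty; apply: noT; exists q, r.
  - by exists 0, 1; rewrite mul1r add0r; split=> //; case: idQ.
have prQ x y : Q (x * y) -> Q x \/ Q y.
  move=> Qxy; case: (pselect (Q x)) => [|/hit[q [r [Qq Tx]]]]; first by left.
  case: (pselect (Q y)) => [|/hit[q' [r' [Qq' Ty]]]]; first by right.
  case: (QT _ _ (TM _ _ Tx Ty)).
  have -> : (q + r * x) * (q' + r' * y) =
    (q' + r' * y) * q + (r * x * q' + r * r' * (x * y)) by ring.
  by case: idQ => _ QD QM; apply: QD (QD _ _ _ _); apply: QM.
have [P PQ] := prime_idealr_of idQ Q1 prQ.
exists P; split=> [x /IQ /PQ //|x /PQ /QT //|J idJ PJ JT x Jx].
by apply/PQ; apply: (maxQ' J) => // y /PQ /PJ.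
Qed.

(** Take {1} as multiplicative set: an ideal that misses it is a proper one. *)
Lemma maximal_prime_above I : is_ideal I -> ~ I 1 ->
  exists2 M : prime_idealr R, maximal_ideal M & forall x, I x -> x \in M.
Proof.
move=> idI I1; have [||x Ix xe|M [IM _ maxM]] := @krull_prime I (fun x => x = 1) idI.
- by [].
- by move=> _ _ -> ->; rewrite mulr1.
- by case: I1; rewrite -xe.
exists M => // J MJ x xJ; apply: (maxM _ (is_ideal_idealr J)) => // y yJ y1.
by move: (idealr1 J); rewrite -y1 yJ.
Qed.

(** The ideal M + (x) contains 1, since otherwise maximality would put it inside M. *)
Lemma maximal_inv (M : idealr R) x : maximal_ideal M -> x \notin M ->
  exists y, 1 - y * x \in M.
Proof.
move=> maxM xM.
pose J y := exists q r, q \in M /\ y = q + r * x.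
have idJ : is_ideal J.
  split=> [|y z [q [r [Mq ->]]] [q' [r' [Mq' ->]]]|b y [q [r [Mq ->]]]].
  - by exists 0, 0; rewrite mul0r addr0 rpred0.
  - by exists (q + q'), (r + r'); split; [apply: rpredD | ring].
  - by exists (b * q), (b * r); split; [apply: idealMr | ring].
case: (pselect (J 1)) => [[q [r [Mq e]]]|J1]; first by exists r; rewrite e addrK.
have [J' J'P] := idealr_of idJ J1.
have sMJ y : y \in M -> y \in J'.
  by move=> My; apply/J'P; exists y, 0; rewrite mul0r addr0.
case/negP: xM; apply: (maxM J' sMJ); apply/J'P.
by exists 0, 1; rewrite mul1r add0r rpred0.
Qed.

End Ideals.

Section RegularSequences.
Variable R : comNzRingType.
Implicit Types s : seq R.

(** The half of [regular_sequence] that is transported between rings below; properness is checked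
    only in the local ring. *)
Definition weakly_regular s : Prop :=
  forall i, (i < size s)%N -> forall x,
    ideal_gen (take i s) (s`_i * x) -> ideal_gen (take i s) x.

(* Going down from a prime containing s_0, ..., s_i, avoid the multiplicative
   set of all s_i ^ j * u with u outside that prime. *)
Lemma regular_sequence_chain s : regular_sequence s ->
  exists P : nat -> prime_idealr R, prime_chain (size s) P.
Proof.
case=> regs /(maximal_prime_above (ideal_gen_ideal _))[M _ sM].
(* The chain grows downwards from a maximal ideal: after i steps its bottom [P 0] still contains the
   first [size s - i] entries. *)
suff H i : (i <= size s)%N -> exists P : nat -> prime_idealr R,
    (forall x, ideal_gen (take (size s - i) s) x -> x \in P 0) /\
    prime_chain i P.
  by have [P [_ PP]] := H _ (leqnn _); exists P.
elim: i => [|i IHi] lti.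
  by exists (fun=> M); split=> // x; rewrite subn0 take_size; apply: sM.
have [P [P0 Pch]] := IHi (ltnW lti).
set j := (size s - i.+1)%N.
have ltj : (j < size s)%N by rewrite /j; lia.
have jS : (size s - i = j.+1)%N by rewrite /j -subSn.
have tj : take j.+1 s = rcons (take j s) s`_j by apply: take_nth.
pose T x := exists e u, u \notin P 0 /\ x = s`_j ^+ e * u.
have T1 : T 1 by exists 0, 1; rewrite expr0 mulr1 idealr1.
have TM x y : T x -> T y -> T (x * y).
  move=> [e [u [uP ->]]] [f [v [vP ->]]]; exists (e + f)%N, (u * v).
  by rewrite prime_idealrM negb_or uP vP; split=> //; rewrite exprD; ring.
have genP x : ideal_gen (take j s) x -> x \in P 0.
  move=> gx; apply: P0; rewrite jS tj; apply: ideal_gen_sub gx => y yj.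
  by rewrite mem_rcons in_cons yj orbT.
(* Regularity cancels the factors s_j one by one, which would leave u in the ideal, hence in
   [P 0]. *)
have IT x : ideal_gen (take j s) x -> ~ T x.
  move=> gx [e [u [/negP uP xe]]]; apply: uP; apply: genP.
  elim: e x gx xe => [|e IHe] x gx xe; first by rewrite expr0 mul1r in xe; rewrite -xe.
  apply: (IHe (s`_j ^+ e * u)) => //; apply: regs => //.
  by rewrite mulrA -exprS -xe.
have [Q [sQ QT _]] := krull_prime (ideal_gen_ideal _) T1 TM IT.
exists (fun l => if l is l'.+1 then P l' else Q); split=> // -[_|l ltl]; last exact: Pch.
(* [Q] misses [T], which contains the complement of [P 0] and also s_j, an element of [P 0]. *)
split=> [x xQ|sub].
  case: (boolP (x \in P 0)) => // nx; case: (QT _ xQ).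
  by exists 0, x; rewrite expr0 mul1r.
have /sub : s`_j \in P 0.
  by apply: P0; rewrite jS tj; apply: ideal_gen_mem; rewrite mem_rcons mem_head.
by move/QT; apply; exists 1, 1; rewrite expr1 mulr1 idealr1.
Qed.

End RegularSequences.

(** * Localization *)

Lemma ideal_gen_map (R R' : comNzRingType) (f : {rmorphism R -> R'}) s x :
  ideal_gen s x -> ideal_gen (map f s) (f x).
Proof.
apply: (@ideal_gen_min _ s (fun x => ideal_gen (map f s) (f x))); last first.
  by move=> y ys; apply/ideal_gen_mem/map_f.
case: (ideal_gen_ideal (map f s)) => G0 GD GM.
by split=> [|y z|a y]; rewrite ?rmorph0 ?rmorphD ?rmorphM; [|apply: GD|apply: GM].
Qed.

Section LocalizationTheory.
Variables (R : comNzRingType) (P : prime_idealr R).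
Local Notation L := (localization P).
Local Open Scope quotient_scope.

Definition toloc : R -> L := Localization.toloc P.

Lemma toloc_is_zmod_morphism : zmod_morphism toloc.
Proof.
move=> a b; rewrite /toloc -[_ - _ in RHS]/(Localization.add _ (Localization.opp _)).
by rewrite !piE; apply: Localization.eq_pi => /=; ring.
Qed.

Lemma toloc_is_monoid_morphism : monoid_morphism toloc.
Proof.
split=> // a b; rewrite /toloc -[_ * _ in RHS]/(Localization.mul _ _).
by rewrite !piE; apply: Localization.eq_pi => /=; ring.
Qed.

HB.instance Definition _ :=
  GRing.isZmodMorphism.Build R L toloc toloc_is_zmod_morphism.
HB.instance Definition _ :=
  GRing.isMonoidMorphism.Build R L toloc toloc_is_monoid_morphism.

(** Together with [toloc_inv] and [toloc_eq0], this is all that the rest of the section uses about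
    the ring morphism [toloc]; the quotient no longer appears. *)
Lemma toloc_frac (x : L) : exists a s, s \notin P /\ toloc s * x = toloc a.
Proof.
elim/quotW: x => -[a [s sP]]; exists a, s; split=> //.
rewrite /toloc -[_ * _]/(Localization.mul _ _) !piE.
by apply: Localization.eq_pi => /=; ring.
Qed.

Lemma toloc_inv s : s \notin P -> exists t, t * toloc s = 1.
Proof.
move=> sP; exists (\pi_L (1, exist _ s sP)).
rewrite /toloc -[_ * _]/(Localization.mul _ _) -[1 in RHS]/(Localization.toloc P 1) !piE.
by apply: Localization.eq_pi => /=; ring.
Qed.

Lemma toloc_eq0 a : toloc a = 0 -> exists2 u, u \notin P & u * a = 0.
Proof.
rewrite -[0]/(Localization.toloc P 0) /toloc !piE => /eqP/Localization.eqlP[u uP /= e].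
by exists u => //; move: e; rewrite mul0r subr0 mulr1.
Qed.

Lemma notinM s t : s \notin P -> t \notin P -> s * t \notin P.
Proof. by move=> sP tP; rewrite prime_idealrM negb_or sP. Qed.

Lemma ideal_gen_toloc s y : ideal_gen (map toloc s) y ->
  exists u c, [/\ u \notin P, ideal_gen s c & toloc u * y = toloc c].
Proof.
case: (ideal_gen_ideal s) => G0 GD GM.
apply: (@ideal_gen_min _ (map toloc s) (fun y => exists u c,
  [/\ u \notin P, ideal_gen s c & toloc u * y = toloc c])).
- split=> [|y1 y2 [u1 [c1 [u1P sc1 e1]]] [u2 [c2 [u2P sc2 e2]]]|].
  + by exists 1, 0; rewrite idealr1 mulr0 rmorph0.
  + exists (u1 * u2), (u2 * c1 + u1 * c2); split; first exact: notinM.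
      by apply: GD; apply: GM.
    by rewrite rmorphD !rmorphM /= -e1 -e2; ring.
  move=> x y1 [u1 [c1 [u1P sc1 e1]]]; have [a [t [tP et]]] := toloc_frac x.
  exists (u1 * t), (a * c1); split; [exact: notinM | exact: GM |].
  by rewrite !rmorphM /= -e1 -et; ring.
- move=> _ /mapP[c cs ->]; exists 1, c; rewrite idealr1 rmorph1 mul1r.
  by split=> //; apply: ideal_gen_mem.
Qed.

Lemma localization_noetherian : noetherian R -> noetherian L.
Proof.
move=> /noetherianP noR; apply/noetherianP => I idI.
have [I0 ID IM] := idI.
have [|s sP] := noR (fun a => I (toloc a)).
  by split=> [|a b|a b]; rewrite ?rmorph0 ?rmorphD ?rmorphM; [|apply: ID|apply: IM].
exists (map toloc s) => x; split=> [Ix|]; last first.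
  apply: ideal_gen_min => // _ /mapP[a sa ->].
  exact/sP/ideal_gen_mem.
have [a [t [tP e]]] := toloc_frac x; have [t' e'] := toloc_inv tP.
have -> : x = t' * toloc a by rewrite -e mulrA e' mul1r.
case: (ideal_gen_ideal (map toloc s)) => _ _; apply; apply: ideal_gen_map.
by apply/sP; rewrite -e; apply: IM.
Qed.

(** Flatness of localization by hand: clear denominators, cancel s_i in [R], then divide by a
    unit. *)
Lemma localization_weakly_regular s :
  weakly_regular s -> weakly_regular (map toloc s).
Proof.
move=> regs i; rewrite size_map => lti x; rewrite (nth_map 0) // -map_take.
have [a [d [dP ed]]] := toloc_frac x.
case/ideal_gen_toloc => u [c [uP sc eu]].
(* The relation holds in [R] only up to a factor v outside [P]. *)
have /toloc_eq0[v vP ev] : toloc (u * (s`_i * a) - d * c) = 0.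
  by rewrite rmorphB !rmorphM /= -eu -ed; ring.
have /regs/(ideal_gen_map toloc) : ideal_gen (take i s) (s`_i * (v * u * a)).
  have -> : s`_i * (v * u * a) = v * d * c + v * (u * (s`_i * a) - d * c) by ring.
  by rewrite ev addr0; case: (ideal_gen_ideal (take i s)) => _ _; apply.
move/(_ lti) => h; have [t et] := toloc_inv (notinM (notinM vP uP) dP).
have -> : x = t * toloc (v * u * a).
  by rewrite -[LHS]mul1r -et !rmorphM /= -ed; ring.
by case: (ideal_gen_ideal (map toloc (take i s))) => _ _; apply.
Qed.

(** The extension of [P] to the localization: the fractions with a numerator in [P]. *)
Definition local_max (x : L) : Prop :=
  exists a s, [/\ a \in P, s \notin P & toloc s * x = toloc a].

Lemma local_max_ideal : is_ideal local_max.
Proof.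
split=> [|x y [a [s [aP sP ea]]] [b [t [bP tP eb]]]|z x [a [s [aP sP ea]]]].
- by exists 0, 1; rewrite idealr1 rpred0 mulr0 rmorph0.
- exists (t * a + s * b), (s * t); split; last by rewrite rmorphD !rmorphM /= -ea -eb; ring.
    by apply: rpredD; apply: idealMr.
  exact: notinM.
- have [c [t [tP ec]]] := toloc_frac z.
  exists (c * a), (t * s); split; [exact: idealMr | exact: notinM |].
  by rewrite !rmorphM /= -ea -ec; ring.
Qed.

Lemma local_max_proper : ~ local_max 1.
Proof.
move=> [a [s [aP sP]]]; rewrite mulr1 => /eqP; rewrite -subr_eq0 -rmorphB.
move=> /eqP/toloc_eq0[u uP e]; have : u * (s - a) \in P by rewrite e rpred0.
by rewrite prime_idealrM (negPf uP) /= rpredBr // (negPf sP).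
Qed.

Lemma local_max_toloc a : a \in P -> local_max (toloc a).
Proof. by move=> aP; exists a, 1; rewrite rmorph1 mul1r idealr1. Qed.

(** A fraction whose numerator is outside [P] is a unit; this makes the localization a local
    ring. *)
Lemma sub_local_max (J : idealr L) x : x \in J -> local_max x.
Proof.
move=> xJ; have [a [s [sP e]]] := toloc_frac x; exists a, s; split=> //.
apply/negPn/negP => /toloc_inv[t et].
by move: (idealr1 J); rewrite -et -e mulrA idealMr.
Qed.

(** Contract the primes to [R]. Inclusions stay strict because an ideal of the localization is
    generated by its contraction. *)
Lemma localization_chain e (Q : nat -> prime_idealr L) : prime_chain e Q ->
  exists Q' : nat -> prime_idealr R, prime_chain e Q'.
Proof.
move=> chQ.
have cQ i : {J : prime_idealr R | forall a, a \in J <-> toloc a \in Q i}.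
  apply: prime_idealr_of => [||a b].
  - split=> [|a b|a b]; rewrite ?rmorph0 ?rmorphD ?rmorphM; first exact: rpred0.
      exact: rpredD.
    exact: idealMr.
  - by rewrite rmorph1 idealr1.
  - by rewrite rmorphM prime_idealrM => /orP.
exists (fun i => sval (cQ i)) => i lti; have [sQ nsQ] := chQ i lti.
split=> [a /(svalP (cQ i))/sQ aQ|sub]; first exact/(svalP (cQ i.+1)).
apply: nsQ => x xQ; have [a [s [sP ex]]] := toloc_frac x; have [t et] := toloc_inv sP.
rewrite -[x]mul1r -et -mulrA ex; apply: idealMr; apply/(svalP (cQ i))/sub.
by apply/(svalP (cQ i.+1)); rewrite -ex idealMr.
Qed.

(** The image of [s] is regular, so it yields a chain of primes of the same length. Conversely every
    regular sequence yields a chain, so the bound on chains bounds both the dimension and the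
    depth. *)
Lemma localization_cohen_macaulay (s : seq R) :
    noetherian R -> {subset s <= P} -> weakly_regular s ->
    (forall e (Q : nat -> prime_idealr R), prime_chain e Q -> (e <= size s)%N) ->
  cohen_macaulay_local L.
Proof.
move=> noR sP regs dimR; split; first exact: localization_noetherian.
have [m mP] := idealr_of local_max_ideal local_max_proper.
have maxm : maximal_ideal m by move=> J _ x /sub_local_max/mP.
have reg_sub : {subset map toloc s <= m}.
  by move=> _ /mapP[a sa ->]; apply/mP/local_max_toloc/sP.
have regL : regular_sequence (map toloc s).
  split; first exact: localization_weakly_regular.
  move/(ideal_gen_min (is_ideal_idealr m) reg_sub).
  by rewrite idealr1.
have dimL e (Q : nat -> prime_idealr L) : prime_chain e Q -> (e <= size s)%N.
  by move=> /localization_chain[Q']; apply: dimR.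
exists m; split=> // [m' maxm' x|].
  have sub : {subset m' <= m} by move=> y /sub_local_max/mP.
  by apply/idP/idP; [apply: sub | apply: (maxm' m)].
exists (size s); split; split=> //.
- by have := regular_sequence_chain regL; rewrite size_map.
- by exists (map toloc s); rewrite size_map.
- by move=> t _ /regular_sequence_chain[Q]; apply: dimL.
Qed.

End LocalizationTheory.

(** * Noetherian rings and retracts *)

(** The extension of [I] to [S]. The finite list varies with the element, and sums are handled by
    concatenating lists. *)
Lemma extension_ideal (A S : comNzRingType) (f : {rmorphism A -> S})
    (I : A -> Prop) :
  is_ideal (fun x => exists2 s, forall y, y \in s -> I y & ideal_gen (map f s) x).
Proof.
split=> [|x y [s sI sx] [t tI ty]|a x [s sI sx]].
- by exists [::] => //; case: (ideal_gen_ideal (map f [::])).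
- exists (s ++ t) => [z|]; first by rewrite mem_cat => /orP[/sI|/tI].
  case: (ideal_gen_ideal (map f (s ++ t))) => _ GD _; apply: GD.
    by apply: ideal_gen_sub sx => z; rewrite map_cat mem_cat => ->.
  by apply: ideal_gen_sub ty => z; rewrite map_cat mem_cat => ->; rewrite orbT.
- by exists s => //; case: (ideal_gen_ideal (map f s)) => _ _; apply.
Qed.

Section Retract.
Variables (A S : comNzRingType) (j : {rmorphism A -> S}) (rho : S -> A).
Hypothesis rhoD : {morph rho : x y / x + y}.
Hypothesis rhoM : forall a x, rho (j a * x) = a * rho x.
Hypothesis rho1 : rho 1 = 1.

Lemma retract_cancel a : rho (j a) = a.
Proof. by rewrite -[j a]mulr1 rhoM rho1 mulr1. Qed.

(** By A-linearity, [rho] maps the extension of an ideal back into the ideal; each descent from [S]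
    to [A] below rests on this. *)
Lemma ideal_gen_retract s x : ideal_gen (map j s) x -> ideal_gen s (rho x).
Proof.
have rho0 : rho 0 = 0 by rewrite -(rmorph0 j) retract_cancel.
case=> c ->; rewrite (big_morph rho rhoD rho0).
apply: ideal_sum => [|i _]; first exact: ideal_gen_ideal.
have lti : (i < size s)%N by rewrite -(size_map j s).
rewrite (nth_map 0) // mulrC rhoM mulrC.
by case: (ideal_gen_ideal s) => _ _; apply; apply/ideal_gen_mem/mem_nth.
Qed.

Lemma retract_noetherian : noetherian S -> noetherian A.
Proof.
move=> noS; apply/noetherianP => I idI.
pose T x := exists2 s, (forall y, y \in s -> I y) & ideal_gen (map j s) x.
have idT : is_ideal T by exact: extension_ideal.
have [t tP] := (noetherianP S).1 noS _ idT.
(* The finite list t of generators of the extension involves only finitely many elements of [I];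
   these generate [I]. *)
have [s sI st] : exists2 s, (forall y, y \in s -> I y) &
    forall x, x \in t -> ideal_gen (map j s) x.
  have : forall x, x \in t -> T x by move=> x /ideal_gen_mem/tP.
  elim: {tP} t => [|x t IHt] tT; first by exists [::].
  have [s sI st] : exists2 s, (forall y, y \in s -> I y) &
      forall x, x \in t -> ideal_gen (map j s) x.
    by apply: IHt => y yt; apply: tT; rewrite in_cons yt orbT.
  have [s' s'I s'x] := tT x (mem_head _ _).
  exists (s ++ s') => [z|y]; first by rewrite mem_cat => /orP[/sI|/s'I].
  rewrite in_cons map_cat => /orP[/eqP->|/st sy].
    by apply: ideal_gen_sub s'x => z; rewrite mem_cat => ->; rewrite orbT.
  by apply: ideal_gen_sub sy => z; rewrite mem_cat => ->.
exists s => x; split=> [Ix|]; last exact: ideal_gen_min.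
rewrite -[x]retract_cancel; apply: ideal_gen_retract.
apply: (ideal_gen_min (ideal_gen_ideal _) st); apply/tP.
exists [:: x] => [y|]; first by rewrite inE => /eqP->.
exact/ideal_gen_mem/mem_head.
Qed.

Lemma retract_weakly_regular s : weakly_regular (map j s) -> weakly_regular s.
Proof.
move=> regs i lti x h; rewrite -[x]retract_cancel; apply: ideal_gen_retract.
rewrite map_take; apply: regs; rewrite ?size_map // (nth_map 0) // -rmorphM -map_take.
exact: ideal_gen_map.
Qed.

(** The extension of [m] is proper, as [rho] would bring 1 back into [m]. A maximal ideal above it
    contracts to a proper ideal containing [m]. *)
Lemma retract_maximal_above (m : idealr A) : maximal_ideal m ->
  exists2 M : prime_idealr S, maximal_ideal M & forall a, j a \in M -> a \in m.
Proof.
move=> maxm.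
pose T x := exists2 s, {subset s <= m} & ideal_gen (map j s) x.
have idT : is_ideal T by exact: extension_ideal.
have T1 : ~ T 1.
  case=> s sm /ideal_gen_retract; rewrite rho1.
  by move=> /(ideal_gen_min (is_ideal_idealr m) sm); rewrite idealr1.
have [M maxM TM] := maximal_prime_above idT T1; exists M => // a.
have [||J JP] := @idealr_of _ (fun a => j a \in M).
- by split=> [|x y|x y]; rewrite ?rmorph0 ?rmorphD ?rmorphM ?rpred0 //;
    [apply: rpredD | apply: idealMr].
- by rewrite rmorph1 idealr1.
move=> /JP; apply: (maxm J) => x xm; apply/JP/TM; exists [:: x] => [y|].
  by rewrite inE => /eqP->.
exact/ideal_gen_mem/mem_head.
Qed.

End Retract.

(** * Hilbert's basis theorem *)

Section HilbertBasis.

Lemma noetherian_surj (R R' : comNzRingType) (f : {rmorphism R -> R'}) :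
  (forall y, exists x, f x = y) -> noetherian R -> noetherian R'.
Proof.
move=> surj /noetherianP noR; apply/noetherianP => I idI; have [I0 ID IM] := idI.
have [|s sP] := noR (fun x => I (f x)).
  by split=> [|x y|x y]; rewrite ?rmorph0 ?rmorphD ?rmorphM; [|apply: ID|apply: IM].
exists (map f s) => y; split=> [Iy|].
  have [x xy] := surj y; rewrite -xy; apply: ideal_gen_map; apply/sP.
  by rewrite xy.
apply: ideal_gen_min => // _ /mapP[x xs ->]; exact/sP/ideal_gen_mem.
Qed.

Lemma noetherian_field (k : fieldType) : noetherian k.
Proof.
apply/noetherianP => I [I0 ID IM].
case: (pselect (exists2 x, I x & x != 0)) => [[x Ix x0]|noI].
  exists [:: x] => y; split=> _; rewrite -[y](divfK x0); last exact: IM.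
  by case: (ideal_gen_ideal [:: x]) => _ _; apply; apply/ideal_gen_mem/mem_head.
exists [::] => y; split=> [Iy|[c ->]]; last by rewrite big_ord0.
case: (eqVneq y 0) => [->|y0]; last by case: noI; exists y.
by case: (ideal_gen_ideal ([::] : seq k)).
Qed.

Variable R : comNzRingType.

(** Bounding the size, instead of fixing the degree, lets the d-th coefficient vanish, so that sums
    stay in the set. *)
Lemma coef_ideal (I : {poly R} -> Prop) d : is_ideal I ->
  is_ideal (fun x => exists2 p : {poly R}, I p /\ (size p <= d.+1)%N & p`_d = x).
Proof.
case=> I0 ID IM; split=> [|x y [p [Ip sp] <-] [q [Iq sq] <-]|a x [p [Ip sp] <-]].
- by exists 0; rewrite ?coef0 //; split=> //; rewrite size_poly0.
- exists (p + q); rewrite ?coefD //; split; first exact: ID.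
  by rewrite (leq_trans (size_polyD _ _)) // geq_max sp.
- exists (a%:P * p); rewrite ?coefCM //; split; first exact: IM.
  by rewrite mul_polyC (leq_trans (size_scale_leq _ _)).
Qed.

Lemma size_mulXn_leq (p : {poly R}) d e :
  (size p <= d.+1)%N -> (size (p * 'X^e)%R <= (d + e).+1)%N.
Proof. by move=> sp; rewrite (leq_trans (size_polyMleq _ _)) // size_polyXn; lia. Qed.

Lemma lead_coef_ideal (I : {poly R} -> Prop) : is_ideal I ->
  is_ideal (fun x => exists2 p : nat * {poly R},
    I p.2 /\ (size p.2 <= p.1.+1)%N & p.2`_p.1 = x).
Proof.
move=> idI; have [I0 ID IM] := idI.
split=> [|x y [[d p] [/= Ip sp] <-] [[e q] [/= Iq sq] <-]|a x [[d p] [/= Ip sp] <-]].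
- by exists (0%N, 0); rewrite /= ?coef0 //; split; rewrite /= ?size_poly0.
(* The two shifts align both coefficients in degree d + e. *)
- exists ((d + e)%N, p * 'X^e + q * 'X^d); last first.
    by rewrite /= coefD !coefMXn ltnNge leq_addl ltnNge leq_addr /= addnK addKn.
  split=> /=; first by apply: ID; rewrite mulrC; apply: IM.
  rewrite (leq_trans (size_polyD _ _)) // geq_max size_mulXn_leq //.
  by rewrite addnC size_mulXn_leq.
- exists (d, a%:P * p); rewrite /= ?coefCM //; split; first exact: IM.
  by rewrite mul_polyC (leq_trans (size_scale_leq _ _)).
Qed.

(* The ideal of leading coefficients of I takes care of the large degrees, the
   ideals of coefficients of each small degree of the others. *)
Lemma noetherian_poly : noetherian R -> noetherian {poly R}.
Proof.
move=> noR; apply/noetherianP => I idI; have [I0 ID IM] := idI.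
have [t [tI tP]] := noetherian_lift noR (lead_coef_ideal idI).
have /choice[T TP] d := noetherian_lift noR (coef_ideal d idI).
(* From degree [D] on, every element of [t] can be shifted up to the degree at hand; below [D] the
   lists [T d] serve. *)
pose D := \max_(p <- t) p.1.
pose G := map snd t ++ flatten [seq T d | d <- iota 0 D].
have GI p : p \in G -> I p.
  rewrite mem_cat => /orP[/mapP[q /tI[Iq _] -> //]|/flattenP[u /mapP[d _ ->]]].
  by case: (TP d) => + _ => /[apply]-[].
have idG := ideal_gen_ideal G; have [_ GD GM] := idG.
exists G => p; split=> [|gp]; last exact: ideal_gen_min gp.
have [n] := ubnP (size p); elim: n p => // n IHn p ltpn Ip.
case: (eqVneq p 0) => [->|p0]; first by case: idG.
have sp : size p = (size p).-1.+1 by rewrite prednK // size_poly_gt0.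
set d := (size p).-1 in sp.
suff [q [Gq sq] qd] : exists2 q, ideal_gen G q /\ (size q <= d.+1)%N & q`_d = p`_d.
  rewrite -[p](subrK q); apply: GD => //; apply: IHn; last first.
    by apply: idealB => //; apply: ideal_gen_min Gq.
  rewrite sp ltnS in ltpn; apply: leq_ltn_trans ltpn; apply/leq_sizeP => i.
  rewrite leq_eqVlt coefB => /orP[/eqP<-|ltdi]; first by rewrite qd subrr.
  by rewrite !nth_default ?subr0 // ?sp // (leq_trans sq).
case: (leqP D d) => [leDd|ltdD].
  have := tP (d, p) (conj Ip (eq_leq sp)).
  apply: ideal_gen_min (coef_ideal d idG) _ _ => _ /mapP[[e g] gt ->] /=.
  have [_ /= sg] := tI _ gt.
  have led : (e <= d)%N by apply: leq_trans leDd; apply: (@leq_bigmax_seq _ _ predT fst _ gt).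
  exists (g * 'X^(d - e)); last by rewrite coefMXn ltnNge leq_subr /= subKn.
  split; last by rewrite -[X in (_ <= X.+1)%N](subnKC led) size_mulXn_leq.
  rewrite mulrC; apply: GM; apply: ideal_gen_mem; rewrite mem_cat.
  by apply/orP; left; apply/mapP; exists (e, g).
have [Td Tp] := TP d; have := Tp p (conj Ip (eq_leq sp)).
apply: ideal_gen_min (coef_ideal d idG) _ _ => _ /mapP[g gt ->] /=.
exists g => //; split; last by case: (Td _ gt).
apply: ideal_gen_mem; rewrite mem_cat; apply/orP; right; apply/flattenP.
by exists (T d) => //; apply: map_f; rewrite mem_iota.
Qed.

End HilbertBasis.

(** * Polynomial rings *)

Section MPolyTools.

Lemma mpoly_alg_ind n (R : comNzRingType) (P : {mpoly R[n]} -> Prop) :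
    (forall c, P c%:MP) -> (forall i, P 'X_i) ->
    (forall p q, P p -> P q -> P (p + q)) ->
    (forall p q, P p -> P q -> P (p * q)) ->
  forall p, P p.
Proof.
move=> PC PX PD PM; elim/mpolyind => [|c m p _ _ Pp]; first by rewrite -mpolyC0.
apply: PD => //; rewrite -mul_mpolyC; apply: (PM) => //.
rewrite mpolyXE_id; apply: (big_ind P) => [||i _]; [by rewrite -mpolyC1 | exact: PM |].
by elim: (m i) => [|e IHe]; rewrite ?expr0 -?mpolyC1 // exprS; apply: PM.
Qed.

Lemma mpoly_rmorphism_eq n (R T : comNzRingType)
    (phi psi : {rmorphism {mpoly R[n]} -> T}) :
  (forall c, phi c%:MP = psi c%:MP) -> (forall i, phi 'X_i = psi 'X_i) ->
  phi =1 psi.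
Proof.
move=> eqC eqX; elim/mpoly_alg_ind => // p q ep eq.
  by rewrite !rmorphD ep eq.
by rewrite !rmorphM ep eq.
Qed.

Lemma mmapX1 n (R : nzRingType) (T : comNzRingType) (f : {rmorphism R -> T})
    (h : 'I_n -> T) i : mmap f h 'X_i = h i.
Proof. by rewrite mmapX mmap1U. Qed.

Definition ffun_last (T : Type) n (f : 'I_n -> T) (h : T) (i : 'I_n.+1) : T :=
  oapp f h (unlift ord_max i).

Lemma ffun_last_max (T : Type) n (f : 'I_n -> T) h : ffun_last f h ord_max = h.
Proof. by rewrite /ffun_last unlift_none. Qed.

Lemma ffun_last_lift (T : Type) n (f : 'I_n -> T) h j :
  ffun_last f h (lift ord_max j) = f j.
Proof. by rewrite /ffun_last liftK. Qed.

Lemma ord_maxP n (P : 'I_n.+1 -> Prop) :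
  P ord_max -> (forall j, P (lift ord_max j)) -> forall i, P i.
Proof. by move=> Pm Pl i; case: (unliftP ord_max i) => [j|] ->. Qed.

Variables (n : nat) (R : comNzRingType).
Local Notation MP := {mpoly R[n]}.

Definition mpoly_uni : {mpoly R[n.+1]} -> {poly MP} :=
  mmap (polyC \o @mpolyC n R) (ffun_last (fun j => ('X_j)%:P) 'X).

HB.instance Definition _ := GRing.RMorphism.on mpoly_uni.

Definition uni_mpoly : {poly MP} -> {mpoly R[n.+1]} :=
  horner_eval 'X_ord_max
    \o map_poly (mmap (@mpolyC n.+1 R) (fun j : 'I_n => 'X_(lift ord_max j))).

HB.instance Definition _ := GRing.RMorphism.on uni_mpoly.

(** This side of the isomorphism gives what is used later: [uni_mpoly] is onto and [mpoly_uni] is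
    injective. *)
Lemma mpoly_uniK : cancel mpoly_uni uni_mpoly.
Proof.
apply: (mpoly_rmorphism_eq (phi := uni_mpoly \o mpoly_uni) (psi := idfun)) => [c|].
  by rewrite /= /mpoly_uni mmapC /uni_mpoly /= map_polyC /= mmapC /horner_eval hornerC.
by apply: ord_maxP => [|j]; rewrite /= /mpoly_uni mmapX1 ?ffun_last_max ?ffun_last_lift;
  rewrite /uni_mpoly /= ?map_polyX ?map_polyC /= ?mmapX1 /horner_eval ?hornerX ?hornerC.
Qed.

Lemma mpoly_uni_eq0 p : mpoly_uni p = 0 -> p = 0.
Proof. by move=> p0; rewrite -[p]mpoly_uniK p0 rmorph0. Qed.

Lemma mmap_ffun_last (T : comNzRingType) (f : {rmorphism R -> T})
    (h : 'I_n -> T) (x : T) p :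
  mmap f (ffun_last h x) p = (map_poly (mmap f h) (mpoly_uni p)).[x].
Proof.
apply: (mpoly_rmorphism_eq (phi := mmap f (ffun_last h x))
  (psi := horner_eval x \o (map_poly (mmap f h) \o mpoly_uni))) => [c|].
  by rewrite /= mmapC /mpoly_uni mmapC /= map_polyC /= mmapC /horner_eval hornerC.
by apply: ord_maxP => [|j]; rewrite /= /mpoly_uni !mmapX1 ?ffun_last_max ?ffun_last_lift;
  rewrite ?map_polyX ?map_polyC /= ?mmapX1 /horner_eval ?hornerX ?hornerC.
Qed.

End MPolyTools.

Lemma noetherian_mpoly n (k : fieldType) : noetherian {mpoly k[n]}.
Proof.
elim: n => [|n IHn].
  apply: (@noetherian_surj k _ (@mpolyC 0 k)); last exact: noetherian_field.
  by move=> y; exists y@_0; apply: mpolyKC.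
apply: (@noetherian_surj _ _ (@uni_mpoly n k)); last exact: noetherian_poly.
by move=> y; exists (mpoly_uni y); apply: mpoly_uniK.
Qed.

(** * Algebraic independence and the bound on chains of primes *)

Section AlgebraicIndependence.
Variables (k : fieldType) (A : comNzRingType) (f : {rmorphism k -> A}).

(** For an ideal [P], the independence over k of the classes in A / P, without forming the
    quotient. *)
Definition alg_indep_mod (P : {pred A}) d (h : 'I_d -> A) : Prop :=
  forall F, mmap f h F \in P -> F = 0.

Lemma alg_indep_modS (P : {pred A}) d (h : 'I_d -> A) (x : A) :
    (forall G : {poly {mpoly k[d]}}, (map_poly (mmap f h) G).[x] \in P -> G = 0) ->
  alg_indep_mod P (ffun_last h x).
Proof. by move=> hx F; rewrite mmap_ffun_last => /hx/mpoly_uni_eq0. Qed.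

(* A relation F(h, x) = F_0(h) + x F_1(h, x) modulo P yields F_0(h) = 0 modulo Q. *)
Lemma alg_indep_mod_chain (P : nat -> prime_idealr A) e : prime_chain e P ->
  exists h : 'I_e -> A, alg_indep_mod (P 0) h.
Proof.
elim: e P => [|e IHe] P chP.
  exists (fun=> 0) => F; rewrite -[F]mpolyKC mmapC.
  case: (eqVneq F@_0 0) => [->|F0 /(idealMr (f (F@_0)^-1))]; first by rewrite mpolyC0.
  by rewrite -rmorphM mulVf // rmorph1 idealr1.
have [h hP] := IHe (P \o S) (fun i lti => chP i.+1 lti).
have [PQ nQP] := chP 0 isT.
have [x xQ xP] : exists2 x, x \in P 1%N & x \notin P 0%N.
  apply: contrapT => nex; apply: nQP => x xQ; apply: contrapT => xP.
  by apply: nex; exists x => //; apply/negP.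
exists (ffun_last h x); apply: alg_indep_modS.
elim/poly_ind => // G c IHG.
rewrite rmorphD rmorphM /= map_polyX map_polyC /= hornerD hornerMX hornerC => GP.
have c0 : c = 0.
  apply: hP => /=; have := rpredB (PQ _ GP) (idealMr (map_poly (mmap f h) G).[x] xQ).
  by rewrite addrC addKr.
(* What remains is a multiple of x, and the prime [P 0] does not contain x. *)
move: GP; rewrite c0 rmorph0 !addr0 prime_idealrM (negPf xP) orbF => /IHG ->.
by rewrite mul0r.
Qed.

End AlgebraicIndependence.

(* There are more monomials in n+1 variables with exponents less than D than
   monomials in n variables with exponents less than C * D, for D large. *)
Lemma mpoly_alg_dependent (k : fieldType) n (h : 'I_n.+1 -> {mpoly k[n]}) :
  exists2 F : {mpoly k[n.+1]}, F != 0 & mmap (@mpolyC n k) h F = 0.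
Proof.
pose c := \max_i msize (h i).
(* A product of powers of the h_i with exponents below D has size at most E = D C, and (D C)^n <
   D^(n+1) because C^n < D. *)
pose C := (n.+1 * c).+1; pose D := (C ^ n).+1; pose E := (D * C)%N.
pose rows := {ffun 'I_n.+1 -> 'I_D}; pose cols := {ffun 'I_n -> 'I_E}.
pose row_mon (a : rows) : 'X_{1..n.+1} := [multinom (a i : nat) | i < n.+1].
pose col_mon (b : cols) : 'X_{1..n} := [multinom (b i : nat) | i < n].
pose hp (a : rows) := \prod_i h i ^+ a i.
(* Each row lists coefficients of one product of powers; with more rows than columns, a nonzero row
   vector v kills the matrix and provides the coefficients of F. *)
pose M := \matrix_(a < #|rows|, b < #|cols|)
  (hp (enum_val a))@_(col_mon (enum_val b)).
have lt_card : (#|cols| < #|rows|)%N.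
  rewrite !card_ffun !card_ord expnMn expnS.
  by rewrite mulnC ltn_pmul2r ?ltnSn // expn_gt0.
have /rowV0Pn[v /sub_kermxP vM v0] : kermx M != 0.
  rewrite -mxrank_eq0 mxrank_ker subn_eq0 -ltnNge.
  exact: leq_ltn_trans (rank_leq_col _) lt_card.
pose F := \sum_a v 0 a *: 'X_[row_mon (enum_val a)].
exists F.
  apply: contraNneq v0 => F0; apply/eqP/rowP => a; rewrite mxE.
  have := congr1 (mcoeff (row_mon (enum_val a))) F0.
  rewrite mcoeff0 /F raddf_sum (bigD1 a) //= mcoeffZ mcoeffX eqxx mulr1.
  rewrite big1 ?addr0 // => b neq_ba; rewrite mcoeffZ mcoeffX.
  case: eqP => [/mnmP e|]; last by rewrite mulr0.
  case/eqP: neq_ba; apply: enum_val_inj; apply/ffunP => i; apply: val_inj.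
  by have := e i; rewrite !mnmE.
have Fh : mmap (@mpolyC n k) h F = \sum_a v 0 a *: hp (enum_val a).
  rewrite /F raddf_sum; apply: eq_bigr => a _ /=.
  rewrite mmapZ mmapX -mul_mpolyC; congr (_ * _).
  by apply: eq_bigr => i _; rewrite mnmE.
have sz_hp a : (msize (hp a) <= E)%N.
  (* Degree at most m, with p = 0 allowed: such bounds add up in products. *)
  pose le (p : {mpoly k[n]}) m := (msize p <= m.+1)%N.
  have le1 : le 1 0%N by rewrite /le msize1.
  have leM p q l m : le p l -> le q m -> le (p * q) (l + m)%N.
    rewrite /le; have [->|p0] := eqVneq p 0; first by rewrite mul0r msize0.
    have [->|q0] := eqVneq q 0; first by rewrite mulr0 msize0.
    rewrite msizeM //; move: (msize p) (msize q) => a' b'; lia.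
  have leX i : le (h i ^+ a i) (D.-1 * c)%N.
    have : le (h i ^+ a i) (a i * c)%N.
      elim: (a i : nat) => // e IHe; rewrite exprS mulSn; apply: leM => //.
      exact/leqW/leq_bigmax.
    move/leq_trans; apply; rewrite ltnS leq_mul2r; apply/orP; right.
    by have := ltn_ord (a i); rewrite /D ltnS.
  have : le (hp a) (\sum_(i < n.+1) D.-1 * c)%N.
    by apply: (big_ind2 le) => // *; apply: leM.
  by rewrite /le sum_nat_const card_ord /E /C => /leq_trans; apply; rewrite /D /=; nia.
rewrite Fh; apply/mpolyP => m; rewrite mcoeff0 raddf_sum /=.
case: (boolP [forall i, m i < E]%N) => [/forallP ltm|].
  have [b bm] : exists b : 'I_#|cols|, col_mon (enum_val b) = m.
    exists (enum_rank [ffun i => Ordinal (ltm i)]); rewrite enum_rankK.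
    by apply/mnmP => i; rewrite mnmE ffunE.
  have := congr1 (fun w : 'rV_#|cols| => w 0 b) vM; rewrite !mxE => e; rewrite -[RHS]e.
  by apply: eq_bigr => a _; rewrite mcoeffZ mxE bm.
rewrite negb_forall => /existsP[i]; rewrite -leqNgt => leEm.
rewrite big1 // => a _; rewrite mcoeffZ memN_msupp_eq0 ?mulr0 //.
apply/negP => /msize_mdeg_lt; rewrite ltnNge => /negP; apply.
apply: leq_trans (sz_hp _) (leq_trans leEm _).
by rewrite mdegE (bigD1 i) //= leq_addr.
Qed.

(** A longer chain would give n + 1 elements independent modulo [P 0], whereas their images in n
    variables satisfy a relation, which injectivity pulls back to [A]. *)
Lemma mpoly_subalg_chain_le (k : fieldType) (A : comNzRingType) n
    (f : {rmorphism k -> A}) (j : {rmorphism A -> {mpoly k[n]}})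
    (P : nat -> prime_idealr A) e :
    injective j -> (forall c, j (f c) = c%:MP) -> prime_chain e P -> (e <= n)%N.
Proof.
move=> inj_j jf chP; rewrite leqNgt; apply/negP => lt_ne.
have [i lti|h hP] := @alg_indep_mod_chain k A f P n.+1.
  by apply: chP; apply: leq_trans lt_ne.
have [F F0 Fh] := mpoly_alg_dependent (j \o h).
case/eqP: F0; apply: hP; rewrite (_ : mmap f h F = 0) ?rpred0 //.
apply: inj_j; rewrite rmorph0 -[RHS]Fh.
apply: (mpoly_rmorphism_eq (phi := j \o mmap f h) (psi := mmap _ _)) => [c|i] /=.
  by rewrite !mmapC jf.
by rewrite !mmapX1.
Qed.

(* With d the degree of p, c^(d-1) p(x) is a monic polynomial in c x. *)
Lemma integral_lead_coef (C K : comNzRingType) (f : {rmorphism C -> K})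
    (p : {poly C}) x :
  (1 < size p)%N -> (map_poly f p).[x] = 0 -> integralOver f (f (lead_coef p) * x).
Proof.
move=> sp px; set c := lead_coef p; set d := (size p).-1.
have sd : size p = d.+1 by rewrite /d prednK // ltnW.
have d0 : (0 < d)%N by rewrite -ltnS -sd.
pose q := \poly_(i < d.+1) (if i == d then 1 else p`_i * c ^+ (d.-1 - i)).
have sq : size q = d.+1 by rewrite size_poly_eq // eqxx oner_neq0.
exists q; first by rewrite monicE /lead_coef sq coef_poly ltnSn eqxx.
rewrite /root (@horner_coef_wide _ d.+1); last by rewrite -sq size_poly.
transitivity (f (c ^+ d.-1) * (map_poly f p).[x] == 0); last by rewrite px mulr0 eqxx.
congr (_ == _); rewrite (@horner_coef_wide _ d.+1); last by rewrite -sd size_poly.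
rewrite mulr_sumr; apply: eq_bigr => i _; rewrite !coef_map coef_poly ltn_ord.
rewrite exprMn !mulrA -!rmorphXn -!rmorphM; congr (f _ * _).
case: (eqVneq (i : nat) d) => [->|neq_id].
  by rewrite mul1r -[in LHS](prednK d0) exprS mulrC.
have lt_id : (i < d)%N by rewrite ltn_neqAle neq_id -ltnS ltn_ord.
have le_id : (i <= d.-1)%N by rewrite -ltnS prednK.
by rewrite -mulrA -exprD (subnK le_id) mulrC.
Qed.

(** * The Nullstellensatz over an arbitrary field *)

Section Nullstellensatz.
Variables (k : fieldType) (n : nat) (M : prime_idealr {mpoly k[n]}).
Hypothesis maxM : maximal_ideal M.
Local Notation S := {mpoly k[n]}.
Local Notation ev h := (mmap (@mpolyC n k) h).
Local Notation indep := (alg_indep_mod (@mpolyC n k) M).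

(** Otherwise independent families of every length would exist, but n + 1 elements of S are always
    dependent. *)
Lemma alg_indep_max : exists d (h : 'I_d -> S), indep h /\
  forall g : 'I_d.+1 -> S, ~ indep g.
Proof.
apply: contrapT => nomax.
have : forall d, exists h : 'I_d -> S, indep h.
  elim=> [|d [h hM]]; last first.
    apply: contrapT => nog; apply: nomax; exists d, h; split=> // g gM.
    by apply: nog; exists g.
  exists (fun=> 0) => F; rewrite -[F]mpolyKC mmapC.
  case: (eqVneq F@_0 0) => [->|F0 /(idealMr ((F@_0)^-1)%:MP)].
    by rewrite mpolyC0.
  by rewrite -mpolyCM mulVf // mpolyC1 idealr1.
move=> /(_ n.+1)[h hM]; have [F /eqP F0 Fh] := mpoly_alg_dependent h.
by apply/F0/hM; rewrite Fh rpred0.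
Qed.

(* Zariski's lemma: all elements become integral over k[h_1, ..., h_d] after
   multiplication by a power of one nonzero r in this ring, for a transcendence
   basis h of the quotient field. For the inverse of 1 + r h_1 this makes
   1 + r h_1 divide a power of r, impossible unless d = 0. *)
Lemma nullstellensatz (s : S) :
  exists2 p : {poly k}, p != 0 & (map_poly (@mpolyC n k) p).[s] \in M.
Proof.
have [d [h [hM maxh]]] := alg_indep_max.
have rel x : exists2 G : {poly {mpoly k[d]}}, G != 0 &
    (map_poly (ev h) G).[x] \in M.
  apply: contrapT => noG; apply: (maxh (ffun_last h x)).
  apply: alg_indep_modS => G GM; apply/eqP/negPn/negP => G0.
  by apply: noG; exists G.
(* For d = 0 the relation for s has coefficients in k, as claimed; a positive d leads to a
   contradiction. *)
case: d => [|d] in h hM maxh rel *.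
  have [G G0 GM] := rel s; exists (map_poly (@mcoeff 0 k 0%MM) G).
    apply: contraNneq G0 => e; apply/eqP/polyP => i.
    have := congr1 (fun p : {poly k} => p`_i) e; rewrite coef_map !coef0 /= => e0.
    by rewrite -[G`_i]mpolyKC e0 mpolyC0.
  move: GM; congr (_ \in M); congr horner; apply/polyP => i.
  by rewrite !coef_map /= -[X in mmap _ _ X]mpolyKC mmapC.
have [Q [pi piM]] : exists (Q : comNzRingType) (pi : {rmorphism S -> Q}),
    forall x, (pi x == 0) = (x \in M).
  exists {ideal_quot M}, (\pi_{ideal_quot M})%qT => x.
  by rewrite -[x in RHS]subr0 Quotient.idealrBE -(rmorph0 (\pi_{ideal_quot M})%qT).
pose C := {mpoly k[d.+1]}.
have [phi phiE] : exists phi : {rmorphism C -> Q}, phi =1 pi \o ev h.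
  by exists (pi \o ev h).
have phi_inj x : phi x = 0 -> x = 0.
  by move/eqP; rewrite phiE /= piM => /hM.
have /choice[G GP] i : exists G : {poly C}, G != 0 /\
    (map_poly (ev h) G).['X_i] \in M.
  by have [G] := rel 'X_i; exists G.
(* A single r clears the leading coefficients of the relations of all the variables. *)
pose r := \prod_i lead_coef (G i).
have r0 : r != 0 by apply/prodf_neq0 => i _; rewrite lead_coef_eq0; case: (GP i).
have intX i : integralOver phi (phi r * pi 'X_i).
  rewrite /r (bigD1 i) //= [X in phi X]mulrC rmorphM -mulrA.
  apply: integral_mul; first exact: integral_id.
  have [G0 GM] := GP i; apply: integral_lead_coef.
    rewrite ltnNge; apply: contra G0 => /size1_polyC e.
    by move: GM; rewrite e map_polyC hornerC => /hM ->.
  have -> : map_poly phi (G i) = map_poly pi (map_poly (ev h) (G i)).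
    by rewrite -map_poly_comp; apply: eq_map_poly.
  by rewrite horner_map; apply/eqP; rewrite piM.
(* These x form a subalgebra containing the variables, hence all of S. *)
pose T x := exists e, integralOver phi (phi r ^+ e * pi x).
have TD x y : T x -> T y -> T (x + y).
  move=> [e ex] [f fy]; exists (e + f)%N.
  have -> : phi r ^+ (e + f) * pi (x + y) =
    phi (r ^+ f) * (phi r ^+ e * pi x) + phi (r ^+ e) * (phi r ^+ f * pi y).
    by rewrite exprD rmorphD !rmorphXn; ring.
  by apply: integral_add; apply: integral_mul => //; apply: integral_id.
have TM x y : T x -> T y -> T (x * y).
  move=> [e ex] [f fy]; exists (e + f)%N.
  have -> : phi r ^+ (e + f) * pi (x * y) =
    (phi r ^+ e * pi x) * (phi r ^+ f * pi y) by rewrite exprD rmorphM; ring.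
  exact: integral_mul.
have TC c : T c%:MP.
  exists 0%N; rewrite expr0 mul1r; have <- : phi c%:MP = pi c%:MP.
    by rewrite phiE /= mmapC.
  exact: integral_id.
have TX i : T 'X_i by exists 1%N; rewrite expr1.
have TT := @mpoly_alg_ind n k T TC TX TD TM.
pose X0 : C := 'X_ord0; pose H := 1 + r * X0.
have H0 : H != 0.
  apply/eqP => /(congr1 (meval (fun=> 0))).
  rewrite mevalD meval1 mevalM mevalXU mulr0 addr0 meval0.
  exact/eqP/oner_neq0.
have [z zH] : exists z, pi z * phi H = 1.
  have /(maximal_inv maxM)[z] : ev h H \notin M by apply: contra H0 => /hM ->.
  by rewrite -piM rmorphB rmorph1 rmorphM subr_eq0 => /eqP; exists z; rewrite phiE.
have [e [p mon_p /rootP pz]] := TT z.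
pose N := (size p).-1.
have sp : size p = N.+1 by rewrite prednK // size_poly_gt0 monic_neq0.
(* Multiply the integral equation of r^e z, of degree N, by H^N. As z inverts H, the leading term
   becomes r^(e N) and the others become multiples of H; injectivity of [phi] brings the equation
   back to [C]. *)
have [w wH] : exists w, r ^+ (e * N) = w * H.
  exists (- \sum_(i < N) p`_i * r ^+ (e * i) * H ^+ (N - i.+1)).
  have term i c : (i <= N)%N ->
      phi H ^+ N * (phi c * (phi r ^+ e * pi z) ^+ i) =
      phi (c * r ^+ (e * i) * H ^+ (N - i)).
    move=> leiN; rewrite !rmorphM !rmorphXn exprMn -exprM -{1}(subnK leiN) exprD.
    transitivity (phi c * phi r ^+ (e * i) * phi H ^+ (N - i) *
      (phi H ^+ i * pi z ^+ i)); first by ring.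
    by rewrite -exprMn mulrC [X in X ^+ i]mulrC zH expr1n mul1r.
  apply/eqP; rewrite mulNr -subr_eq0 opprK; apply/eqP/phi_inj.
  rewrite -[RHS](mulr0 (phi H ^+ N)) -[in RHS]pz.
  rewrite (@horner_coef_wide _ N.+1); last by rewrite -sp size_poly.
  rewrite mulr_sumr big_ord_recr rmorphD addrC mulr_suml rmorph_sum.
  congr (_ + _); last first.
    rewrite coef_map term // (_ : p`_N = 1) ?mul1r ?subnn ?expr0 ?mulr1 //.
    by have/monicP := mon_p; rewrite /lead_coef sp.
  apply: eq_bigr => i _; rewrite coef_map term ?(ltnW (ltn_ord i)) //.
  by rewrite -(subnSK (ltn_ord i)) exprSr !mulrA.
(* With m = e N, H divides both (- r X0)^m, a multiple of r^m, and 1 - (- r X0)^m. *)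
have Hdvd : exists v, 1 = v * H.
  exists ((- X0) ^+ (e * N) * w + \sum_(i < e * N) (- (r * X0)) ^+ i).
  have := subrX1 (- (r * X0)) (e * N).
  rewrite (_ : - (r * X0) - 1 = - H); last by rewrite /H; ring.
  rewrite -mulrN exprMn wH => /eqP; rewrite subr_eq => /eqP e1.
  by rewrite mulrDl -mulrA [X in X + _]mulrC e1; ring.
have [v vH] := Hdvd.
have v0 : v != 0 by apply: contra_eqN vH => /eqP->; rewrite mul0r oner_neq0.
(* As a unit, H is constant, whereas r X0 has positive degree. *)
have szH : (msize H <= 1)%N.
  have := congr1 (fun x : C => msize x) vH; rewrite msize1 msizeM //.
  by move: v0 H0; rewrite -!msize_poly_eq0; move: (msize v) (msize H); lia.
have e2 : r * X0 = (H@_0 - 1)%:MP.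
  by rewrite mpolyCB mpolyC1 -msize1_polyC // /H addrC addKr.
have X00 : X0 != 0 by rewrite -msize_poly_eq0 msizeX.
have := congr1 (fun x : C => msize x) e2; rewrite msizeM // msizeX mdeg1 msizeC.
have : (0 < msize r)%N by rewrite lt0n msize_poly_eq0.
by case: (msize r) => // l _; rewrite addnC; case: (_ != _).
Qed.

End Nullstellensatz.

(** * Substitutions preserving regular sequences *)

(** The e_j form a basis of C over B, so a relation over C splits into one relation over B per
    coordinate. *)
Lemma free_weakly_regular (B C : comNzRingType) (f : {rmorphism B -> C}) m
    (e : 'I_m -> C) (s : seq B) :
    (forall x, exists b : 'I_m -> B, x = \sum_j f (b j) * e j) ->
    (forall b : 'I_m -> B, \sum_j f (b j) * e j = 0 -> forall j, b j = 0) ->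
  weakly_regular s -> weakly_regular (map f s).
Proof.
move=> gen_e free_e regs i; rewrite size_map => lti x.
rewrite (nth_map 0) // -map_take => -[c].
have [b ->] := gen_e x; have /choice[d dP] l := gen_e (c l).
set t := take i s => ex.
have st l : (l < size (map f t))%N -> (l < size t)%N by rewrite size_map.
have relj j : s`_i * b j = \sum_(l < size (map f t)) d l j * t`_l.
  apply/eqP; rewrite -subr_eq0; apply/eqP; move: j; apply: free_e.
  transitivity (f s`_i * (\sum_j f (b j) * e j) - \sum_l c l * (map f t)`_l).
    rewrite mulr_sumr.
    transitivity (\sum_j (f s`_i * (f (b j) * e j) -
        \sum_(l < size (map f t)) f (d l j) * e j * (map f t)`_l)).
      apply: eq_bigr => j _; rewrite rmorphB rmorphM rmorph_sum mulrBl mulrA mulr_suml.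
      congr (_ - _); apply: eq_bigr => l _; rewrite rmorphM (nth_map 0) ?st //; ring.
    rewrite sumrB exchange_big; congr (_ - _); apply: eq_bigr => l _.
    by rewrite -mulr_suml -dP.
  by rewrite ex subrr.
apply: ideal_sum => [|j _]; first exact: ideal_gen_ideal.
case: (ideal_gen_ideal (map f t)) => _ _ GM; rewrite mulrC; apply: GM.
apply: ideal_gen_map; apply: regs => //; rewrite relj.
apply: ideal_sum => [|l _]; first exact: ideal_gen_ideal.
case: (ideal_gen_ideal t) => _ _; apply; apply/ideal_gen_mem/mem_nth.
exact: st.
Qed.

(** Splitting the constant terms off the b_j writes the sum as W g + L with L of degree less than
    that of g. Since g is monic, W = L = 0, and the induction on the sizes applies to W. *)
Lemma comp_monic_free (R : comNzRingType) (g : {poly R}) m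
    (b : 'I_m -> {poly R}) :
    g \is monic -> size g = m.+1 ->
    \sum_j (b j \Po g) * 'X^j = 0 -> forall j, b j = 0.
Proof.
move=> mon_g sg; have [N] : exists N, forall j, (size (b j) <= N)%N.
  by exists (\max_j size (b j)) => j; apply: leq_bigmax.
elim: N b => [|N IHN] b szb sum0 j; first by apply/eqP; rewrite -size_poly_leq0 szb.
pose b' j := \poly_(i < N) (b j)`_i.+1.
have bE i : b i = b' i * 'X + ((b i)`_0)%:P.
  apply/polyP => l; rewrite coefD coefMX coefC coef_poly.
  case: l => [|l] /=; first by rewrite add0r.
  by rewrite addr0; case: ltnP => // ?; rewrite nth_default // (leq_trans (szb _)).
pose W := \sum_i (b' i \Po g) * 'X^i.
pose L := \poly_(i < m) (oapp (fun j => (b j)`_0) 0 (insub i)).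
have sumE : W * g + L = 0.
  rewrite -[RHS]sum0 /L poly_def mulr_suml -big_split; apply: eq_bigr => i _ /=.
  rewrite valK /= [in RHS](bE i) comp_polyD comp_polyM comp_polyX comp_polyC -mul_polyC.
  by ring.
have W0 : W = 0.
  apply/eqP/negPn/negP => W0.
  have : (size (- L) <= m)%N by rewrite size_polyN size_poly.
  rewrite -[- L]add0r -sumE addrK leqNgt => /negP; apply.
  by rewrite size_Mmonic // sg addnS /= -[X in (X < _)%N]add0n ltn_add2r size_poly_gt0.
have L0 : L = 0 by rewrite -sumE W0 mul0r add0r.
rewrite (bE j) (IHN b') // => [|i]; last exact: size_poly.
have := congr1 (fun p : {poly R} => p`_j) L0.
by rewrite coef_poly ltn_ord valK coef0 /= => ->; rewrite mul0r add0r.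
Qed.

(** The b_j are the coefficients of the remainder of q by g, which takes the same value as q at the
    root t. *)
Lemma monic_root_generate (B C : comNzRingType) (f : {rmorphism B -> C}) t m
    (g q : {poly B}) :
    g \is monic -> size g = m.+1 -> (map_poly f g).[t] = 0 ->
  exists b : 'I_m -> B, (map_poly f q).[t] = \sum_j f (b j) * t ^+ j.
Proof.
move=> mon_g sg gt0; exists (fun j => (Pdiv.Ring.rmodp q g)`_j).
rewrite {1}(Pdiv.RingMonic.rdivp_eq mon_g q) rmorphD rmorphM /= hornerD hornerM.
rewrite gt0 mulr0 add0r (@horner_coef_wide _ m) => [|].
  by apply: eq_bigr => j _; rewrite coef_map.
by rewrite (leq_trans (size_poly _ _)) // -ltnS -sg Pdiv.Ring.ltn_rmodpN0 ?monic_neq0.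
Qed.

(* B is free over itself along kappa, the substitution of g for the variable t,
   when g is monic in t; here tau views the elements of B as polynomials in t. *)
Lemma monic_subst_weakly_regular (B : comNzRingType) (kappa : {rmorphism B -> B})
    (tau : {rmorphism B -> {poly B}}) (t g : B) (s : seq B) :
    (forall p, (map_poly kappa (tau p)).[t] = p) ->
    (forall p, tau (kappa p) = tau p \Po tau g) -> kappa t = g -> tau t = 'X ->
    tau g \is monic -> (1 < size (tau g))%N ->
  weakly_regular s -> weakly_regular (map kappa s).
Proof.
move=> tauK tau_kappa kappat taut mon_g sg; pose m := (size (tau g)).-1.
have sgm : size (tau g) = m.+1 by rewrite prednK // ltnW.
have tau_inj : injective tau by move=> p q e; rewrite -(tauK p) e tauK.
apply: (@free_weakly_regular _ _ kappa m (fun j => t ^+ j)) => [x|b e].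
  (* Applying [kappa] to the coefficients sends the constant t to g, which turns g' into g(T) - g: a
     monic equation of t over the image of [kappa]. *)
  pose g' := tau g - t%:P.
  have st : (size (- t%:P : {poly B}) < size (tau g))%N.
    by rewrite size_polyN (leq_ltn_trans (size_polyC_leq1 _)).
  have sg' : size g' = m.+1 by rewrite size_polyDl.
  have mon_g' : g' \is monic by rewrite monicE lead_coefDl ?(monicP mon_g).
  rewrite -(tauK x); apply: monic_root_generate mon_g' sg' _.
  by rewrite rmorphB /= map_polyC /= !hornerE tauK kappat subrr.
move=> j; apply: tau_inj; rewrite rmorph0; move: j.
apply: (comp_monic_free mon_g sgm).
rewrite -[RHS](rmorph0 tau) -[in RHS]e rmorph_sum; apply: eq_bigr => j _.
by rewrite rmorphM rmorphXn tau_kappa taut.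
Qed.

(** * Tuples whose substitution preserves regular sequences *)

Section RegularTuples.
Variables (k : fieldType) (n : nat).
Local Notation S := {mpoly k[n]}.
Local Notation ev h := (mmap (@mpolyC n k) h).
Implicit Types (a i : 'I_n) (h : 'I_n -> S).

Definition replace (T : Type) (h : 'I_n -> T) a (u : T) i : T :=
  if i == a then u else h i.

(** A polynomial seen as one in X_a, with coefficients kept in S though X_a does not occur in them;
    the number of variables stays n. *)
Definition poly_in a : S -> {poly S} :=
  mmap (polyC \o @mpolyC n k) (replace (fun i => ('X_i)%:P) a 'X).

HB.instance Definition _ a := GRing.RMorphism.on (poly_in a).

Local Notation subst a u := (ev (replace (fun i : 'I_n => 'X_i) a u)).

Lemma poly_inC a c : poly_in a c%:MP = c%:MP%:P.
Proof. by rewrite /poly_in mmapC. Qed.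

Lemma poly_inX a i : poly_in a 'X_i = if i == a then 'X else ('X_i)%:P.
Proof. by rewrite /poly_in mmapX1. Qed.

Lemma substX a u : subst a u 'X_a = u.
Proof. by rewrite mmapX1 /replace eqxx. Qed.

Lemma poly_inK a u p : (map_poly (subst a u) (poly_in a p)).['X_a] = p.
Proof.
apply: (mpoly_rmorphism_eq (psi := idfun)
  (phi := horner_eval 'X_a \o (map_poly (subst a u) \o poly_in a))) => [c|i] /=.
  by rewrite poly_inC map_polyC /= mmapC /horner_eval hornerC.
rewrite poly_inX; case: eqP => [->|/eqP neq_ia].
  by rewrite map_polyX /horner_eval hornerX.
by rewrite map_polyC /= mmapX1 /replace (negPf neq_ia) /horner_eval hornerC.
Qed.

Lemma poly_in_subst a g p : poly_in a (subst a g p) = poly_in a p \Po poly_in a g.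
Proof.
apply: (mpoly_rmorphism_eq (phi := poly_in a \o subst a g)
  (psi := comp_poly (poly_in a g) \o poly_in a)) => [c|i] /=.
  by rewrite mmapC !poly_inC comp_polyC.
rewrite mmapX1 poly_inX /replace; case: eqP => [_|/eqP neq_ia].
  by rewrite comp_polyX.
by rewrite poly_inX (negPf neq_ia) comp_polyC.
Qed.

Lemma subst_weakly_regular a g s :
    poly_in a g \is monic -> (1 < size (poly_in a g))%N ->
  weakly_regular s -> weakly_regular (map (subst a g) s).
Proof.
apply: monic_subst_weakly_regular; first exact: poly_inK.
- exact: poly_in_subst.
- exact: substX.
- by apply: etrans (poly_inX a a) _; rewrite eqxx.
Qed.

(** Setting the first l variables to 0 has as kernel the ideal they generate and fixes X_l, which
    can be cancelled in the domain S. *)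
Lemma variables_weakly_regular :
  weakly_regular [seq 'X_i : S | i <- enum 'I_n].
Proof.
move=> l; rewrite size_map size_enum_ord => ltl x.
set s := map _ _; pose l' := Ordinal ltl.
pose rho : {rmorphism S -> S} := ev (fun j => if (j < l)%N then 0 else 'X_j).
have sl : s`_l = 'X_l' by rewrite /s (nth_map l') ?size_enum_ord // (nth_ord_enum _ l').
have idI := ideal_gen_ideal (take l s); have [I0 ID IM] := idI.
have modI : forall y, ideal_gen (take l s) (y - rho y).
  apply: mpoly_alg_ind => [c|j|p q Ip Iq|p q Ip Iq].
  - by rewrite /= mmapC subrr.
  - rewrite /= mmapX1; case: ltnP => [ltj|_]; last by rewrite subrr.
    rewrite subr0; apply: ideal_gen_mem; apply/(nthP 0); exists j.
      by rewrite size_take size_map size_enum_ord ltl.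
    by rewrite nth_take // (nth_map j) ?size_enum_ord // nth_ord_enum.
  - by rewrite rmorphD opprD addrACA; apply: ID.
  - have -> : p * q - rho (p * q) = p * (q - rho q) + rho q * (p - rho p).
      by rewrite rmorphM; ring.
    by apply: ID; apply: IM.
rewrite sl => Ix; have rI y : ideal_gen (take l s) y -> rho y = 0.
  apply: (ideal_gen_min (I := fun y => rho y = 0)).
    split=> [|p q p0 q0|p q q0]; first exact: rmorph0.
      by rewrite rmorphD p0 q0 addr0.
    by rewrite rmorphM q0 mulr0.
  move=> z /(nthP 0)[j]; rewrite size_take size_map size_enum_ord ltl => ltj <-.
  have ltjn := ltn_trans ltj ltl.
  rewrite nth_take // (nth_map l') ?size_enum_ord //.
  by rewrite /= mmapX1 nth_enum_ord // ltj.
have := modI x; suff -> : rho x = 0 by rewrite subr0.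
have /eqP := rI _ Ix; rewrite rmorphM mulf_eq0 /= mmapX1 ltnn => /orP[|/eqP//].
by rewrite -msize_poly_eq0 msizeX.
Qed.

(** Quantifying over all sequences, beyond the variables, lets substitutions be composed. *)
Definition preserves_regular h : Prop :=
  forall s : seq S, weakly_regular s -> weakly_regular (map (ev h) s).

Lemma preserves_regular_vars : preserves_regular (fun i => 'X_i).
Proof.
move=> s; rewrite (_ : map _ s = s) // map_id_in // => p _.
by apply: (mpoly_rmorphism_eq (psi := idfun) (phi := ev (fun i => 'X_i))) => [c|i] /=;
  rewrite ?mmapC ?mmapX1.
Qed.

Lemma preserves_regular_tuple h :
  preserves_regular h -> weakly_regular [seq h i | i <- enum 'I_n].
Proof.
move=> /(_ _ variables_weakly_regular); rewrite -map_comp.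
by congr weakly_regular; apply: eq_map => i; apply: mmapX1.
Qed.

(* The subring generated over k by the h_i with i <> a: [poly_in a p = p%:P] says
   that X_a does not occur in p. *)
Definition others h a (y : S) : Prop :=
  exists2 p, poly_in a p = p%:P & ev h p = y.

Lemma othersC h a c : others h a c%:MP.
Proof. by exists c%:MP; rewrite ?poly_inC ?mmapC. Qed.

Lemma others_var h a i : i != a -> others h a (h i).
Proof. by move=> /negPf ia; exists 'X_i; rewrite ?poly_inX ?ia ?mmapX1. Qed.

Lemma othersD h a x y : others h a x -> others h a y -> others h a (x + y).
Proof.
by move=> [p pp <-] [q qq <-]; exists (p + q); rewrite ?rmorphD //= pp qq.
Qed.

Lemma othersM h a x y : others h a x -> others h a y -> others h a (x * y).
Proof.
by move=> [p pp <-] [q qq <-]; exists (p * q); rewrite ?rmorphM //= pp qq.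
Qed.

Lemma othersN h a x : others h a x -> others h a (- x).
Proof. by move=> [p pp <-]; exists (- p); rewrite ?rmorphN //= pp. Qed.

(** The exchange step. Lifting the coefficients of g to polynomials without X_a yields b, monic in
    X_a; evaluation at the new tuple is the substitution of b for X_a followed by evaluation at
    [h]. *)
Lemma preserves_regular_replace h a (g : {poly S}) :
    preserves_regular h -> g \is monic -> (1 < size g)%N ->
    (forall l : nat, others h a g`_l) ->
  preserves_regular (replace h a g.[h a]).
Proof.
move=> reg_h mon_g sg og s regs.
have /choice[c cP] (l : nat) : exists p, poly_in a p = p%:P /\ ev h p = g`_l.
  by have [p pp pg] := og l; exists p.
pose m := (size g).-1; have sgm : size g = m.+1 by rewrite prednK // ltnW.
(* The leading coefficient is set to 1 directly, since the chosen lift of 1 may differ from 1. *)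
pose G : {poly S} := 'X^m + \poly_(j < m) c j.
have sG : size G = m.+1 by rewrite size_polyDl size_polyXn // ltnS size_poly.
have mon_G : G \is monic.
  by rewrite monicE lead_coefDl ?lead_coefXn // size_polyXn ltnS size_poly.
pose b := G.['X_a].
have bG : poly_in a b = G.
  rewrite /b -horner_map /= poly_inX eqxx (_ : map_poly _ _ = map_poly polyC G).
    by rewrite -/(comp_poly 'X G) comp_polyXr.
  rewrite /G !rmorphD /= !map_polyXn; congr (_ + _).
  apply/polyP => i; rewrite !coef_map !coef_poly.
  by case: ltnP => _ /=; [case: (cP i) | rewrite rmorph0 polyC0].
have evG : map_poly (ev h) G = g.
  rewrite /G rmorphD /= map_polyXn; apply/polyP => i.
  rewrite coefD coefXn coef_map coef_poly.
  case: (ltngtP i m) => [ltim|ltmi|->]; rewrite /= ?mmap0 ?add0r ?addr0.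
  - by case: (cP i).
  - by rewrite [RHS]nth_default // sgm.
  - by have/monicP := mon_g; rewrite /lead_coef => <-.
have evb : ev h b = g.[h a] by rewrite /b -horner_map evG /= mmapX1.
have -> : map (ev (replace h a g.[h a])) s =
    map (ev h) (map (subst a b) s).
  rewrite -map_comp; apply: eq_map.
  apply: (mpoly_rmorphism_eq (phi := ev (replace h a g.[h a]))
    (psi := ev h \o subst a b)) => [e|i] /=; first by rewrite !mmapC.
  by rewrite !mmapX1 /replace; case: eqP => [_|_]; rewrite ?evb ?mmapX1.
by apply: reg_h; apply: subst_weakly_regular; rewrite ?bG ?sG -?sgm.
Qed.

(** Entries are replaced one at a time; the coefficients of p_i are constants, so they lie in the
    algebra of the other entries. *)
Lemma preserves_regular_polys h (p : 'I_n -> {poly k}) :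
    (forall i, p i \is monic) -> (forall i, 1 < size (p i))%N ->
    preserves_regular h ->
  preserves_regular (fun i => (map_poly (@mpolyC n k) (p i)).[h i]).
Proof.
move=> mon_p sp reg_h.
suff H l : (l <= n)%N -> preserves_regular (fun i : 'I_n =>
    if (i < l)%N then (map_poly (@mpolyC n k) (p i)).[h i] else h i).
  have := H n (leqnn n); congr preserves_regular; apply/funext => i.
  by rewrite ltn_ord.
elim: l => [|l IHl] ltln; first exact: reg_h.
set h' := (h' in preserves_regular h') in IHl; pose a := Ordinal ltln.
have := preserves_regular_replace (a := a) (IHl (ltnW ltln)) 
  (monic_map (@mpolyC n k) (mon_p a)).
rewrite size_map_poly => /(_ (sp a)); rewrite /h' /= ltnn => H.
rewrite (_ : (fun _ => _) = replace h' a (map_poly (@mpolyC n k) (p a)).[h a]).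
  by apply: H => i; rewrite coef_map; apply: othersC.
apply/funext => i; rewrite /replace /h' ltnS leq_eqVlt -val_eqE /=.
by case: eqP => // e; rewrite (_ : i = a) //; apply: val_inj.
Qed.

End RegularTuples.

(** * The coefficients of prod_i (T - x_i) *)

Section AffineVariables.
Variables (k : fieldType) (n : nat).
Local Notation S := {mpoly k[n]}.

Definition affine_var : 'I_n.+1 -> S :=
  ffun_last (fun j => 'X_j) (1 - \sum_(j < n) 'X_j).
Local Notation x := affine_var.

Lemma affine_var_lt (i : 'I_n.+1) (j : 'I_n) : i = j :> nat -> x i = 'X_j.
Proof.
move=> ij; rewrite (_ : i = lift ord_max j); first exact: ffun_last_lift.
by apply: val_inj; rewrite /= /bump leqNgt ltn_ord.
Qed.

Lemma affine_var_sum : \sum_i x i = 1.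
Proof.
rewrite big_ord_recr /= [X in _ + X]ffun_last_max addrC.
by rewrite (eq_bigr (fun j : 'I_n => 'X_j)) ?subrK // => j _; apply: affine_var_lt.
Qed.

Definition affine_seq : seq S := [seq x i | i <- enum 'I_n.+1].
Local Notation rs := affine_seq.

Lemma size_affine_seq : size rs = n.+1.
Proof. by rewrite size_map size_enum_ord. Qed.

Lemma nth_affine_seq (i : 'I_n) : rs`_i = 'X_i.
Proof.
have lti : (i < n.+1)%N by rewrite ltnW ?ltnS.
rewrite (nth_map ord0) ?size_enum_ord //; apply: affine_var_lt.
by rewrite nth_enum_ord.
Qed.

Definition affine_poly : {poly S} := \prod_(y <- rs) ('X - y%:P).
Local Notation F := affine_poly.

Lemma affine_polyE : F = \prod_i ('X - (x i)%:P).
Proof. by rewrite /F big_map big_enum. Qed.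

(** [F] is monic of degree n + 1, and its next coefficient is minus the sum of the x_i, which is
    1. *)
Lemma affine_poly_coef_gt l : (n <= l)%N -> F`_l = - 1 \/ F`_l = 1 \/ F`_l = 0.
Proof.
have sF : size F = n.+2 by rewrite size_prod_XsubC size_affine_seq.
rewrite leq_eqVlt => /orP[/eqP<-|ltnl]; first left.
  have := @coefPn_prod_XsubC _ rs; rewrite size_affine_seq => /(_ isT) ->.
  by rewrite big_map big_enum affine_var_sum.
right; case: (ltngtP l n.+1) => [||->]; first by lia.
  by move=> lt; right; rewrite nth_default // sF.
by left; have := monic_prod_XsubC rs predT id; rewrite monicE /lead_coef sF => /eqP.
Qed.

(** * The exchange at position a: variables before it, coefficients after it *)

Section Split.
Variables (h : 'I_n -> S) (a : 'I_n).
Hypothesis hlt : forall i : 'I_n, (i < a)%N -> h i = 'X_i.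
Hypothesis hgt : forall i : 'I_n, (a < i)%N -> h i = - F`_i.
Local Notation D := (others h a).

Lemma others0 : D 0. Proof. by rewrite -mpolyC0; apply: othersC. Qed.

Lemma others_prod_XsubC (r : seq S) l :
  (forall y, y \in r -> D y) -> D (\prod_(y <- r) ('X - y%:P))`_l.
Proof.
elim: r l => [|y r IHr] l rD.
  by rewrite big_nil coef1 -mpolyC_nat; apply: othersC.
have {}IHr l' : D (\prod_(y <- r) ('X - y%:P))`_l'.
  by apply: IHr => z zr; apply: rD; rewrite in_cons zr orbT.
rewrite big_cons mulrBl coefB coefXM coefCM; apply: othersD.
  by case: eqP => _ //; apply: others0.
by apply/othersN/othersM => //; apply/rD/mem_head.
Qed.

Lemma others_affine_coef l : (a < l)%N -> D F`_l.
Proof.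
move=> lt_al; case: (ltnP l n) => [lt_ln|/affine_poly_coef_gt].
  rewrite -[F`_l]opprK -(hgt (i := Ordinal lt_ln)) //; apply/othersN/others_var.
  by rewrite -val_eqE /= gtn_eqF.
have D1 : D 1 by rewrite -mpolyC1; apply: othersC.
by case=> [->|[] ->]; [apply: othersN | | apply: others0].
Qed.

(* Division of F by the product M of the T - X_i with i < a leaves a monic P with
   root X_a, whose coefficients lie in k[X_i, F_l : i < a < l] except that the
   constant one does so only after subtracting the coefficient F_a. *)
Lemma affine_coef_monic : exists2 g : {poly S}, g \is monic /\ (1 < size g)%N &
  (forall l : nat, D g`_l) /\ g.['X_a] = - F`_a.
Proof.
have lt_a : (a < n.+1)%N by rewrite ltnW ?ltnS.
pose M := \prod_(y <- take a rs) ('X - y%:P); pose P := \prod_(y <- drop a rs) ('X - y%:P).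
have FE : F = M * P by rewrite /F -(cat_take_drop a rs) big_cat.
have sM : size M = a.+1.
  by rewrite size_prod_XsubC size_take size_affine_seq lt_a.
have M1 : M`_a = 1.
  by have := monic_prod_XsubC (take a rs) predT id; rewrite monicE /lead_coef sM => /eqP.
have sP : size P = (n.+1 - a).+1.
  by rewrite size_prod_XsubC size_drop size_affine_seq.
have monP : P \is monic by apply: monic_prod_XsubC.
have rootP : P.['X_a] = 0.
  apply/eqP; rewrite -[_ == 0]/(root P 'X_a) root_prod_XsubC.
  rewrite (drop_nth 0) ?size_affine_seq // nth_affine_seq mem_head //.
have DM l : D M`_l.
  apply: others_prod_XsubC => y /(nthP 0)[i]; rewrite size_take size_affine_seq lt_a.
  move=> lt_ia <-; have lt_in := ltn_trans lt_ia (ltn_ord a).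
  rewrite nth_take // (nth_affine_seq (Ordinal lt_in)) -hlt //.
  by apply: others_var; rewrite -val_eqE /= ltn_eqF.
(* In degree a + j of F = M P, the monic M of degree a contributes P_j, and its lower coefficients
   meet only higher coefficients of P. *)
have step j : (forall l, (j < l)%N -> D P`_l) -> D (P`_j - F`_(a + j)).
  move=> DP; have lt_aj : (a < (a + j).+1)%N by rewrite ltnS leq_addr.
  rewrite FE coefM (bigD1 (Ordinal lt_aj)) //= M1 mul1r addKn opprD addNKr.
  apply/othersN; elim/big_ind: _ => [|y z|i neq_ia]; [exact: others0 | exact: othersD |].
  case: (ltnP a i) => [lt_ai|le_ia].
    by rewrite nth_default ?sM // mul0r; apply: others0.
  apply: othersM => //; apply: DP.
  have : (i < a)%N by rewrite ltn_neqAle le_ia andbT; apply: contra neq_ia; rewrite -val_eqE.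
  by lia.
(* Descending induction on l; for l > 0 the coefficient F_(a + l) belongs to [D]. *)
have DP : forall l, (0 < l)%N -> D P`_l.
  move=> l; have [d] := ubnP (n.+2 - l); elim: d l => // d IHd l ltd l0.
  rewrite -[P`_l](subrK F`_(a + l)); apply: othersD; last first.
    by apply: others_affine_coef; lia.
  apply: step => l' lt_ll'; case: (leqP (size P) l') => [|lt_l'].
    by move/(nth_default 0) ->; apply: others0.
  by apply: IHd; rewrite sP in lt_l'; lia.
have sPC : (size (- (F`_a)%:P : {poly S}) < size P)%N.
  rewrite size_polyN (leq_ltn_trans (size_polyC_leq1 _)) // sP ltnS.
  by rewrite subn_gt0.
exists (P - (F`_a)%:P); split.
- by rewrite monicE lead_coefDl ?(monicP monP).
- by rewrite size_polyDl // sP ltnS subn_gt0.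
- move=> [|l]; rewrite coefB coefC /=; last by rewrite subr0; apply: DP.
  by rewrite -[in F`_ _](addn0 a); apply: step => l; apply: DP.
- by rewrite hornerD hornerN hornerC rootP sub0r.
Qed.

End Split.

Lemma affine_coef_preserves_regular :
  preserves_regular (fun i : 'I_n => - F`_i).
Proof.
suff H b : (b <= n)%N ->
    preserves_regular (fun i : 'I_n => if (i < n - b)%N then 'X_i else - F`_i).
  by have := H n (leqnn n); rewrite subnn.
elim: b => [|b IHb] ltbn.
  rewrite (_ : (fun _ => _) = (fun i : 'I_n => 'X_i)); first exact: preserves_regular_vars.
  by apply/funext => i; rewrite subn0 ltn_ord.
have lta : (n - b.+1 < n)%N by lia.
set h := (h in preserves_regular h) in IHb; pose a := Ordinal lta.
have ha : h a = 'X_a by rewrite /h ifT //=; lia.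
have [||g [mon_g sg] [og ga]] := @affine_coef_monic h a.
- by move=> i /= lti; rewrite /h ifT //; lia.
- by move=> i /= lti; rewrite /h ifF //; apply/negbTE; lia.
have := preserves_regular_replace (IHb (ltnW ltbn)) mon_g sg og.
rewrite ha ga; congr preserves_regular; apply/funext => i.
rewrite /replace /h -val_eqE /=; case: eqP => [->|neq]; first by rewrite ltnn.
by congr (if _ then _ else _); lia.
Qed.

End AffineVariables.

(** Rescale the polynomial; it is not constant, since a nonzero constant in [M] would be a unit. *)
Lemma nullstellensatz_monic (k : fieldType) n (M : prime_idealr {mpoly k[n]})
    (s : {mpoly k[n]}) : maximal_ideal M ->
  exists p : {poly k}, [/\ p \is monic, (1 < size p)%N
    & (map_poly (@mpolyC n k) p).[s] \in M].
Proof.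
move=> maxM; have [p p0 ps] := nullstellensatz maxM s.
have lp0 : lead_coef p != 0 by rewrite lead_coef_eq0.
exists ((lead_coef p)^-1 *: p); split.
- by rewrite monicE lead_coefZ mulVf.
- rewrite size_scale ?invr_eq0 // ltnNge; apply/negP => /size1_polyC e.
  move: ps; rewrite e map_polyC hornerC /= => /(idealMr ((p`_0)^-1)%:MP).
  rewrite -mpolyCM mulVf ?mpolyC1 ?idealr1 //.
  by apply: contraNneq p0 => p00; rewrite e p00.
- by rewrite map_polyZ /= hornerZ idealMr.
Qed.

(** * The affine action *)

Section AffineAction.
Variables (G : finGroupType) (k : fieldType) (n : nat).
Hypothesis cardG : #|G| = n.+1.
Local Notation S := {mpoly k[n]}.
Local Notation x := (@affine_var k n).

Definition grank (u : G) : 'I_n.+1 := cast_ord cardG (enum_rank u).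
Definition gval (i : 'I_n.+1) : G := enum_val (cast_ord (esym cardG) i).

Lemma grankK : cancel grank gval.
Proof. by move=> u; rewrite /gval cast_ordK enum_rankK. Qed.

Lemma gvalK : cancel gval grank.
Proof. by move=> i; rewrite /grank enum_valK cast_ordKV. Qed.

Lemma sum_grank (V : nmodType) (f : 'I_n.+1 -> V) :
  \sum_(u : G) f (grank u) = \sum_i f i.
Proof. by rewrite [RHS](reindex grank) //; exists gval => ? _; [apply: grankK | apply: gvalK]. Qed.

Definition shift (g : G) (i : 'I_n.+1) : 'I_n.+1 := grank (gval i * g)%g.

Lemma shiftK g : cancel (shift g) (shift g^-1%g).
Proof. by move=> i; rewrite /shift grankK mulgK gvalK. Qed.

Lemma shift_sum (g : G) (V : nmodType) (f : 'I_n.+1 -> V) :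
  \sum_i f (shift g i) = \sum_i f i.
Proof.
rewrite [RHS](reindex (shift g)) //; exists (shift g^-1%g) => i _; first exact: shiftK.
by rewrite -{1}[g]invgK shiftK.
Qed.

Definition affine_hom (g : G) : S -> S :=
  mmap (@mpolyC n k) (fun j : 'I_n => x (shift g (widen_ord (leqnSn n) j))).

HB.instance Definition _ g := GRing.RMorphism.on (affine_hom g).

Lemma affine_homC g c : affine_hom g c%:MP = c%:MP.
Proof. exact: mmapC. Qed.

(** True by definition for i < n. For the last index it follows because the x_i and their translates
    both sum to 1. *)
Lemma affine_hom_var g i : affine_hom g (x i) = x (shift g i).
Proof.
have lt_var (j : 'I_n) : affine_hom g (x (widen_ord (leqnSn n) j)) =
    x (shift g (widen_ord (leqnSn n) j)).
  by rewrite (@affine_var_lt k n _ j) // [LHS]mmapX1.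
case: (ltnP i n) => [lti|le_ni].
  by rewrite (_ : i = widen_ord (leqnSn n) (Ordinal lti)) //; apply: val_inj.
have -> : i = ord_max by apply: val_inj; apply/eqP; rewrite eqn_leq le_ni -ltnS ltn_ord.
have : affine_hom g (\sum_i x i) = \sum_i x (shift g i).
  by rewrite (shift_sum g) affine_var_sum rmorph1.
rewrite rmorph_sum !big_ord_recr (eq_bigr _ (fun j _ => lt_var j)).
exact: addrI.
Qed.

Lemma affine_hom_ext (phi psi : {rmorphism S -> S}) :
    (forall c, phi c%:MP = psi c%:MP) -> (forall i, phi (x i) = psi (x i)) ->
  phi =1 psi.
Proof.
move=> eqC eqx; apply: mpoly_rmorphism_eq => // j.
by rewrite -(@affine_var_lt k n (widen_ord (leqnSn n) j) j).
Qed.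

Definition affine_act (p : S) (g : G) : S := affine_hom g p.

Lemma affine_act1 : affine_act^~ 1%g =1 id.
Proof.
apply: (affine_hom_ext (phi := affine_hom 1) (psi := idfun)) => [c|i].
  exact: affine_homC.
by rewrite /= affine_hom_var /shift mulg1 gvalK.
Qed.

Lemma affine_actM p : act_morph affine_act p.
Proof.
move=> g h; move: p.
apply: (affine_hom_ext (phi := affine_hom (g * h))
  (psi := affine_hom h \o affine_hom g)) => [c|i] /=.
  by rewrite !affine_homC.
by rewrite !affine_hom_var /shift grankK mulgA.
Qed.

Lemma affine_act_linear g : linear (affine_act^~ g).
Proof.
by move=> c p q; rewrite /affine_act rmorphD -!mul_mpolyC rmorphM /= affine_homC.
Qed.

Lemma affine_act_monoid_morphism g : monoid_morphism (affine_act^~ g).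
Proof. by split=> [|p q]; rewrite /affine_act ?rmorph1 ?rmorphM. Qed.

Definition affine_action : alg_action G S :=
  @AlgAction G k S (TotalAction affine_act1 affine_actM)
    affine_act_linear affine_act_monoid_morphism.

(** Evaluation at 0 is 1 on the last x_i and 0 on the others, which are distinct variables. *)
Lemma affine_var_inj : injective x.
Proof.
have x0 (j : 'I_n) : meval (fun=> 0) ('X_j : S) = 0 by rewrite mevalXU.
have xlast (i : 'I_n.+1) : (n <= i)%N -> meval (fun=> 0) (x i) = 1.
  move=> le_ni; rewrite (_ : i = ord_max).
    rewrite /affine_var ffun_last_max mevalB meval1 [X in _ - X]raddf_sum big1 ?subr0 // => j _.
    exact: x0.
  by apply: val_inj; apply/eqP; rewrite eqn_leq le_ni -ltnS ltn_ord.
move=> i j; case: (ltnP i n) => [lti|lei]; case: (ltnP j n) => [ltj|lej].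
- rewrite (@affine_var_lt k n _ (Ordinal lti)) // (@affine_var_lt k n _ (Ordinal ltj)) //.
  move=> e; have /eqP := mcoeffXU k (Ordinal lti) (Ordinal ltj).
  rewrite e mcoeffXU eqxx; case: (Ordinal lti =P Ordinal ltj) => [[ij] _|_]; first exact: val_inj.
  by rewrite oner_eq0.
- rewrite (@affine_var_lt k n _ (Ordinal lti)) // => e; have := xlast _ lej.
  by rewrite -e x0 => /esym/eqP; rewrite oner_eq0.
- rewrite (@affine_var_lt k n j (Ordinal ltj)) // => e; have := xlast _ lei.
  by rewrite e x0 => /esym/eqP; rewrite oner_eq0.
- by move=> _; apply: val_inj => /=; have := ltn_ord i; have := ltn_ord j; lia.
Qed.

Lemma affine_action_faithful : faithful_action affine_action.
Proof.
move=> g /(_ (x (grank 1%g)))/=; rewrite /affine_act affine_hom_var => /affine_var_inj.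
by move/(can_inj grankK); rewrite grankK mul1g.
Qed.

Local Notation A := (invariant_ring affine_action).
Local Notation theta := (x (grank 1%g)).

Lemma trace_invariant (p : S) :
  \sum_(g : G) affine_hom g (theta * p) \in invariants affine_action.
Proof.
apply/invariantsP => h /=; rewrite /affine_act rmorph_sum.
rewrite [RHS](reindex_inj (mulIg h)); apply: eq_bigr => g _.
exact/esym/affine_actM.
Qed.

(* The translates of theta sum to 1, so this is a retraction onto the invariants. *)
Definition retraction (p : S) : A := InvariantRing (trace_invariant p).

Lemma retractionD : {morph retraction : p q / p + q}.
Proof.
move=> p q; apply: val_inj; rewrite /= -big_split; apply: eq_bigr => g _.
by rewrite mulrDr /affine_act rmorphD.
Qed.

Lemma retractionM (b : A) p : retraction (val b * p) = b * retraction p.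
Proof.
apply: val_inj; rewrite /= mulr_sumr; apply: eq_bigr => g _.
rewrite mulrCA /affine_act rmorphM; congr (_ * _).
by have /invariantsP := valP b; apply.
Qed.

Lemma retraction1 : retraction 1 = 1.
Proof.
apply: val_inj; rewrite -[RHS](affine_var_sum k n) -sum_grank /=.
by apply: eq_bigr => g _; rewrite mulr1 affine_hom_var /shift grankK mul1g.
Qed.

(** [G] permutes the roots of [affine_poly]. *)
Lemma affine_coef_invariant (i : 'I_n) :
  - (affine_poly k n)`_i \in invariants affine_action.
Proof.
apply/invariantsP => g /=; rewrite /affine_act rmorphN; congr (- _).
rewrite -[LHS]coef_map; congr (nth 0 (polyseq _) i).
rewrite affine_polyE rmorph_prod /=.
rewrite [RHS](reindex_inj (can_inj (shiftK g))); apply: eq_bigr => j _.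
by rewrite rmorphB /= map_polyX map_polyC /= affine_hom_var.
Qed.

Definition affine_inv (i : 'I_n) : A := InvariantRing (affine_coef_invariant i).

Theorem affine_invariants_cohen_macaulay : cohen_macaulay A.
Proof.
pose j : {rmorphism A -> S} := val.
pose inA : {rmorphism k -> A} := GRing.in_alg A.
have jinA c : j (inA c) = c%:MP by rewrite -alg_mpolyC.
have noA : noetherian A.
  apply: (@retract_noetherian _ _ j _ retractionD retractionM retraction1).
  exact: noetherian_mpoly.
split=> // m maxm.
have [M maxM Mm] := @retract_maximal_above _ _ j _ retractionD retractionM retraction1 m maxm.
have /choice[p pP] i := nullstellensatz_monic (j (affine_inv i)) maxM.
pose c i := (map_poly inA (p i)).[affine_inv i].
have jc i : j (c i) = (map_poly (@mpolyC n k) (p i)).[- (affine_poly k n)`_i].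
  rewrite /c -horner_map -map_poly_comp; congr horner.
  by apply: eq_map_poly => e /=; rewrite -jinA.
(* These n elements of m are regular in S, hence in A, and no chain of primes of A is longer than
   n. *)
pose s := [seq c i | i <- enum 'I_n].
have ss : size s = n by rewrite size_map size_enum_ord.
apply: (localization_cohen_macaulay (s := s)) => //.
- by move=> _ /mapP[i _ ->]; apply: Mm; rewrite jc; case: (pP i).
- apply: (@retract_weakly_regular _ _ j _ retractionD retractionM retraction1).
  rewrite -map_comp (eq_map jc); apply: preserves_regular_tuple.
  apply: preserves_regular_polys; last exact: affine_coef_preserves_regular.
    by move=> i; case: (pP i).
  by move=> i; case: (pP i).
move=> e Q; rewrite ss; apply: (mpoly_subalg_chain_le (f := inA) (j := j)) => //.
exact: val_inj.
Qed.

End AffineAction.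

Theorem corollary0p6 (G : finGroupType) (k : fieldType) :
  exists (n : nat) (a : alg_action G {mpoly k[n]}),
    faithful_action a /\ cohen_macaulay (invariant_ring a).
Proof.
have cardG : #|G| = #|G|.-1.+1 by rewrite prednK //; apply/card_gt0P; exists 1%g.
exists #|G|.-1, (affine_action k cardG); split.
  exact: affine_action_faithful.
exact: affine_invariants_cohen_macaulay.
Qed.
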